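(* The following hold. (1) The big-O problem is undecidable, even when the input weighted automaton is a labelled Markov chain. (2) Each of the four threshold problems (asymmetric non-strict, asymmetric strict, symmetric non-strict, symmetric strict) is undecidable, even under the promise of boundedness. (3) Each of the four approximation tasks (asymmetric additive, asymmetric multiplicative, symmetric additive, symmetric multiplicative) is recursively unsolvable (no algorithm computes a correct output for all inputs), even under the promise of boundedness.
   Context: A (non-negative) weighted automaton is a tuple $\langle Q,\Sigma,M,F\rangle$ with $Q$ a finite set of states, $\Sigma$ a finite alphabet, $M:\Sigma\to\mathbb{Q}_{\ge 0}^{Q\times Q}$ and $F\subseteq Q$ a set of final states; weights are given in binary as numerator/denominator pairs. For $s\in Q$ and $w=a_1\cdots a_n\in\Sigma^*$, the weight of $w$ from $s$ is $\nu_s(w)=\sum_{t\in F}(M(a_1)\cdots M(a_n))_{s,t}$. For states $s,s'$, $s$ is big-O of $s'$ if there is $C>0$ with $\nu_s(w)\le C\,\nu_{s'}(w)$ for all $w\in\Sigma^*$. The big-O problem: given a weighted automaton and states $s,s'$, decide whether $s$ is big-O of $s'$. A labelled Markov chain (LMC) is a weighted automaton such that for every $q\in Q\setminus F$, $\sum_{q'\in Q}\sum_{a\in\Sigma}M(a)(q,q')=1$, and $M(a)(q,q')=0$ for all $a$, all $q\in F$, $q'\in Q$. For an LMC and $E\subseteq\Sigma^*$ put $\nu_s(E)=\sum_{w\in E}\nu_s(w)$. Define $\mathrm{tv}_\times(s,s')=\sup_{E\subseteq\Sigma^*}\nu_s(E)/\nu_{s'}(E)$ with conventions $0/0=0$ and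 $x/0=\infty$ for $x>0$, and $\mathrm{tv}_{\times}^{\mathrm{sym}}(s,s')=\max\{\mathrm{tv}_\times(s,s'),\mathrm{tv}_\times(s',s)\}$. Asymmetric threshold problem: given an LMC, states $s,s'$ and a rational $\theta$, decide whether $\mathrm{tv}_\times(s,s')\le\theta$; the strict variant asks whether $\mathrm{tv}_\times(s,s')<\theta$. The promise of boundedness restricts inputs to those with $\mathrm{tv}_\times(s,s')<\infty$ (a promise problem: on inputs violating the promise, any behaviour is allowed). Asymmetric additive approximation task: given an LMC, $s,s'$ and $\gamma>0$, output $x$ with $|\mathrm{tv}_\times(s,s')-x|\le\gamma$. Asymmetric multiplicative approximation task: output $x$ with $1-\gamma\le x/\mathrm{tv}_\times(s,s')\le1+\gamma$. Symmetric variants replace $\mathrm{tv}_\times$ by $\mathrm{tv}_{\times}^{\mathrm{sym}}$ throughout (including in the promise). *)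

(* Defs.v *)
From HB Require Import structures.
From mathcomp Require Import all_boot all_order all_algebra.
From mathcomp Require Import all_classical all_reals.
From mathcomp Require Import ereal esum.

Set Implicit Arguments.
Unset Strict Implicit.
Unset Printing Implicit Defensive.

Import Order.TTheory GRing.Theory Num.Theory.

(* 1. A model of computation: partial recursive functions nat -> nat,  *)
(*    with tuples coded by the Cantor pairing function.                *)

Definition cpair (x y : nat) : nat := ((x + y) * (x + y).+1) %/ 2 + y.

Inductive code : Type :=
| cZero
| cSucc
| cFst
| cSnd
| cPair of code & code
| cComp of code & code
| cRec  of code & code
| cMu   of code.

Inductive eval : code -> nat -> nat -> Prop :=
| evZero x : eval cZero x 0
| evSucc x : eval cSucc x x.+1
| evFst x y : eval cFst (cpair x y) x
| evSnd x y : eval cSnd (cpair x y) y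
| evPair f g x a b : eval f x a -> eval g x b -> eval (cPair f g) x (cpair a b)
| evComp f g x y z : eval g x y -> eval f y z -> eval (cComp f g) x z
| evRec0 f g x a : eval f x a -> eval (cRec f g) (cpair x 0) a
| evRecS f g x n a b : eval (cRec f g) (cpair x n) a ->
    eval g (cpair x (cpair n a)) b -> eval (cRec f g) (cpair x n.+1) b
| evMu f x n : eval f (cpair x n) 0 ->
    (forall m, m < n -> exists v, eval f (cpair x m) v.+1) ->
    eval (cMu f) x n.

Definition decides {T : Type} (enc : T -> nat) (Pr P : T -> Prop) (c : code) :=
  forall x, Pr x -> (P x -> eval c (enc x) 1) /\ (~ P x -> eval c (enc x) 0).

Definition undecidable {T : Type} (enc : T -> nat) (Pr P : T -> Prop) :=
  ~ exists c, decides enc Pr P c.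

Definition enc_int (z : int) : nat :=
  match z with Posz n => n.*2 | Negz n => n.*2.+1 end.

Definition enc_rat (q : rat) : nat := cpair (enc_int (numq q)) (enc_int (denq q)).

Fixpoint enc_list {A : Type} (f : A -> nat) (l : seq A) : nat :=
  if l is x :: l' then (cpair (f x) (enc_list f l')).+1 else 0.

Definition solves {T : Type} (enc : T -> nat) (Pr : T -> Prop)
    (Good : T -> rat -> Prop) (c : code) :=
  forall x, Pr x -> exists q, eval c (enc x) (enc_rat q) /\ Good x q.

Definition unsolvable {T : Type} (enc : T -> nat) (Pr : T -> Prop)
    (Good : T -> rat -> Prop) :=
  ~ exists c, solves enc Pr Good c.

(*    States are 0..n-1, letters 0..k-1;                               *)
(*    wa_M = [:: M(0); ...; M(k-1)], each M(a) a list of n rows of n   *)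
(*    rational weights; wa_F = characteristic list of final states.    *)

Record WA := MkWA {
  wa_n : nat;
  wa_k : nat;
  wa_M : seq (seq (seq rat));
  wa_F : seq bool }.

Definition enc_WA (A : WA) : nat :=
  cpair (wa_n A) (cpair (wa_k A)
    (cpair (enc_list (enc_list (enc_list enc_rat)) (wa_M A))
           (enc_list nat_of_bool (wa_F A)))).

Definition weight (A : WA) (a q q' : nat) : rat :=
  nth 0%R (nth [::] (nth [::] (wa_M A) a) q) q'.

Definition wf_WA (A : WA) : Prop :=
  size (wa_M A) = wa_k A /\
  (forall a, a < wa_k A -> size (nth [::] (wa_M A) a) = wa_n A /\
     forall q, q < wa_n A -> size (nth [::] (nth [::] (wa_M A) a) q) = wa_n A) /\
  size (wa_F A) = wa_n A /\
  (forall a q q', (0 <= weight A a q q')%R).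

Definition final (A : WA) (q : nat) : bool := nth false (wa_F A) q.

Definition is_LMC (A : WA) : Prop :=
  wf_WA A /\
  (forall q, q < wa_n A -> ~~ final A q ->
     (\sum_(q' < wa_n A) \sum_(a < wa_k A) weight A a q q')%R = 1%R) /\
  (forall q, q < wa_n A -> final A q ->
     forall a q', a < wa_k A -> q' < wa_n A -> weight A a q q' = 0%R).

Section Semantics.
Variable R : realType.
Local Open Scope ring_scope.

Definition word (A : WA) := seq 'I_(wa_k A).

Definition wa_mx (A : WA) (a : 'I_(wa_k A)) : 'M[R]_(wa_n A) :=
  \matrix_(i, j) ratr (weight A a i j).

Definition prod_mx (A : WA) (w : word A) : 'M[R]_(wa_n A) :=
  foldr (fun a P => wa_mx a *m P) 1%:M w.

(* nu_s(w) = sum_{t in F} (M(a1) ... M(an))_{s,t}; 0 if s is not a state *)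
Definition nu (A : WA) (s : nat) (w : word A) : R :=
  if (insub s : option 'I_(wa_n A)) is Some i
  then \sum_(t < wa_n A | final A t) prod_mx w i t
  else 0.

Definition big_O (A : WA) (s s' : nat) : Prop :=
  exists C : R, 0 < C /\ forall w : word A, nu s w <= C * nu s' w.

Local Open Scope ereal_scope.

Definition nuE (A : WA) (s : nat) (E : set (word A)) : \bar R :=
  \esum_(w in E) (nu s w)%:E.

(* x / y with 0/0 = 0 and x/0 = +oo for x > 0 (for LMCs, nu_s(E) <= 1) *)
Definition eratio (x y : \bar R) : \bar R :=
  if y == 0 then (if x == 0 then 0 else +oo) else (fine x / fine y)%:E.

Definition tvx (A : WA) (s s' : nat) : \bar R :=
  ereal_sup [set eratio (nuE s E) (nuE s' E) | E in [set: set (word A)]].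

Definition tvx_sym (A : WA) (s s' : nat) : \bar R :=
  maxe (tvx A s s') (tvx A s' s).

End Semantics.

Definition enc3 (x : WA * nat * nat) : nat :=
  cpair (enc_WA x.1.1) (cpair x.1.2 x.2).
Definition enc4 (x : WA * nat * nat * rat) : nat :=
  cpair (enc_WA x.1.1.1) (cpair x.1.1.2 (cpair x.1.2 (enc_rat x.2))).

Definition states_ok (A : WA) (s s' : nat) := s < wa_n A /\ s' < wa_n A.

Definition bigO_problem_WA (R : realType) :=
  undecidable enc3
    (fun x => wf_WA x.1.1 /\ states_ok x.1.1 x.1.2 x.2)
    (fun x => big_O R x.1.1 x.1.2 x.2).

Definition bigO_problem_LMC (R : realType) :=
  undecidable enc3
    (fun x => is_LMC x.1.1 /\ states_ok x.1.1 x.1.2 x.2)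
    (fun x => big_O R x.1.1 x.1.2 x.2).

(* The LMC problems take inputs x = (A, s, s', r) with r a rational
   (threshold theta or precision gamma).  Promise: A is an LMC, s and s' are
   states, and the distance d (tvx or tvx_sym) is finite on (s, s'). *)
Definition bounded_promise (R : realType) (d : WA -> nat -> nat -> \bar R)
    (x : WA * nat * nat * rat) : Prop :=
  is_LMC x.1.1.1 /\ states_ok x.1.1.1 x.1.1.2 x.1.2 /\
  (d x.1.1.1 x.1.1.2 x.1.2 < +oo)%E.

Definition threshold_problem (R : realType) (d : WA -> nat -> nat -> \bar R) :=
  undecidable enc4 (bounded_promise d)
    (fun x => (d x.1.1.1 x.1.1.2 x.1.2 <= (ratr x.2 : R)%:E)%E).

Definition strict_threshold_problem (R : realType) (d : WA -> nat -> nat -> \bar R) :=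
  undecidable enc4 (bounded_promise d)
    (fun x => (d x.1.1.1 x.1.1.2 x.1.2 < (ratr x.2 : R)%:E)%E).

Definition additive_approx_task (R : realType) (d : WA -> nat -> nat -> \bar R) :=
  unsolvable enc4 (fun x => bounded_promise d x /\ (0 < x.2)%R)
    (fun x q => (`| fine (d x.1.1.1 x.1.1.2 x.1.2) - ratr q | <= (ratr x.2 : R))%R).

Definition multiplicative_approx_task (R : realType) (d : WA -> nat -> nat -> \bar R) :=
  unsolvable enc4 (fun x => bounded_promise d x /\ (0 < x.2)%R)
    (fun x q => let t := fine (d x.1.1.1 x.1.1.2 x.1.2) in
       ((1 - ratr x.2) * t <= ratr q :> R)%R /\ (ratr q <= (1 + ratr x.2) * t :> R)%R).

(* Main.v *)
Require Import Defs.
From HB Require Import structures.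
From mathcomp Require Import all_boot all_order all_algebra.
From mathcomp Require Import all_classical all_reals.
From mathcomp Require Import ereal esum.
From mathcomp Require Import zify ring lra.
Import Defs.

Set Implicit Arguments.
Unset Strict Implicit.
Unset Printing Implicit Defensive.

Import Order.TTheory GRing.Theory Num.Theory.

(** A program [d] is compiled into a nondeterministic loop program whose only
    operations are affine assignments and tests [L = R] between affine forms of
    the variables; a word is a candidate run.  Along a word, the products
    [v_i v_j] of the variables evolve linearly with natural coefficients, so one
    weighted automaton can sum [2 L R] over all tests of the run, plus one, and
    another one [L^2 + R^2].  As [2 L R <= L^2 + R^2], with a defect of at least
    one when [L <> R], the first sum exceeds the second iff all tests pass.
    Concatenating runs multiplies the weights: if [d] halts on [x], the ratio is
    unbounded, and otherwise it is at most [1].  Dividing all weights by a common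
    constant and sending the remaining mass to a dead state yields a labelled
    Markov chain, in which [x] occurs only in the three weights [x^2/D], [x/D],
    [1/D] of the initial step.  Mixing the two initial states with different
    proportions turns the gap into distances that are always finite, and at most
    [2] or at least [8].

    Since [x] occurs in a fixed place of the encoding, no universal machine is
    needed: an algorithm for one of the problems gives a program that fills its
    own template into itself and then contradicts the algorithm on the result. *)

(** * Evaluation of codes *)

Definition tri (d : nat) : nat := (d * d.+1) %/ 2.

Lemma triS d : tri d.+1 = tri d + d.+1.
Proof.
rewrite /tri; have -> : d.+1 * d.+2 = d * d.+1 + d.+1 * 2 by lia.
by rewrite divnDMl.
Qed.

Lemma leq_tri : {homo tri : m n / m <= n}.
Proof.
move=> m n; elim: n => [|n IHn]; first by rewrite leqn0 => /eqP ->.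
rewrite leq_eqVlt => /orP[/eqP -> //|/IHn le_mn].
by rewrite triS (leq_trans le_mn) ?leq_addr.
Qed.

Lemma cpairE x y : cpair x y = tri (x + y) + y.
Proof. by []. Qed.

(** Since [y <= x + y], the code lies between [tri (x + y)] and [tri (x + y).+1], the latter
    excluded. It thus determines the antidiagonal [x + y], and then [y]. *)
Lemma cpair_inj x y x' y' : cpair x y = cpair x' y' -> x = x' /\ y = y'.
Proof.
rewrite !cpairE => eq_c.
have eq_d : x + y = x' + y'.
  case: (ltngtP (x + y) (x' + y')) => // lt_d; have := leq_tri lt_d;
  rewrite triS; lia.
by rewrite eq_d in eq_c; lia.
Qed.

Lemma eval_FstI z a : eval cFst z a -> exists y, z = cpair a y.
Proof. by move=> e; inversion e; subst; exists y. Qed.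

Lemma eval_SndI z a : eval cSnd z a -> exists x, z = cpair x a.
Proof. by move=> e; inversion e; subst; exists x. Qed.

Lemma eval_PairI f g x z : eval (cPair f g) x z ->
  exists a b, [/\ eval f x a, eval g x b & z = cpair a b].
Proof. by move=> e; inversion e; subst; exists a, b. Qed.

Lemma eval_CompI f g x z : eval (cComp f g) x z ->
  exists2 y, eval g x y & eval f y z.
Proof. by move=> e; inversion e; subst; exists y. Qed.

Lemma eval_RecI f g z a : eval (cRec f g) z a ->
  (exists2 x, z = cpair x 0 & eval f x a) \/
  (exists x n b, [/\ z = cpair x n.+1, eval (cRec f g) (cpair x n) b &
                    eval g (cpair x (cpair n b)) a]).
Proof.
by move=> e; inversion e; subst; [left; exists x|right; do 3 eexists; split; eauto].
Qed.

Lemma eval_Rec0I f g x a : eval (cRec f g) (cpair x 0) a -> eval f x a.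
Proof.
by move=> /eval_RecI[[y /cpair_inj[-> _]]|[y [n [b [/cpair_inj[]]]]]].
Qed.

Lemma eval_RecSI f g x n b : eval (cRec f g) (cpair x n.+1) b ->
  exists2 a, eval (cRec f g) (cpair x n) a & eval g (cpair x (cpair n a)) b.
Proof.
move=> /eval_RecI[[y /cpair_inj[]//]|[y [m [a [/cpair_inj[-> [->]] ea ga]]]]].
by exists a.
Qed.

Lemma eval_MuI f x n : eval (cMu f) x n ->
  eval f (cpair x n) 0 /\
  (forall m, m < n -> exists v, eval f (cpair x m) v.+1).
Proof. by move=> e; inversion e; subst. Qed.

(** Determinism lets the diagonal argument turn two predictions about one run into a contradiction.
    The [cRec] case needs an inner induction on the counter, because its premise evaluates the same
    code again. *)
Lemma eval_fun c x y z : eval c x y -> eval c x z -> y = z.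
Proof.
elim: c x y z => [||||f IHf g IHg|f IHf g IHg|f IHf g IHg|f IHf] x y z.
- by move=> e1 e2; inversion e1; inversion e2.
- by move=> e1 e2; inversion e1; inversion e2.
- by move=> /eval_FstI[u ->] /eval_FstI[v] /cpair_inj[].
- by move=> /eval_SndI[u ->] /eval_SndI[v] /cpair_inj[].
- move=> /eval_PairI[a [b [fa gb ->]]] /eval_PairI[a' [b' [fa' gb' ->]]].
  by rewrite (IHf _ _ _ fa fa') (IHg _ _ _ gb gb').
- move=> /eval_CompI[a ga fa] /eval_CompI[a' ga' fa'].
  by rewrite (IHg _ _ _ ga' ga) in fa'; exact: IHf fa fa'.
- move=> e; have [u [n def_x]] : exists u n, x = cpair u n.
    by case: (eval_RecI e) => [[u ->]|[u [n [b [-> _ _]]]]]; do 2 eexists.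
  subst x.
  elim: n y z e => [|n IHn] y z.
    by move=> /eval_Rec0I fy /eval_Rec0I fz; exact: IHf fy fz.
  move=> /eval_RecSI[a ea ga] /eval_RecSI[a' ea' ga'].
  by rewrite (IHn _ _ ea' ea) in ga'; exact: IHg ga ga'.
- move=> /eval_MuI[f0 fS] /eval_MuI[f0' fS'].
  case: (ltngtP y z) => // [/fS'|/fS] [v fv].
    by have := IHf _ _ _ f0 fv.
  by have := IHf _ _ _ f0' fv.
Qed.

(** * Affine loop programs *)

Definition store := nat -> nat.

(* [(c, l)] is the affine form [c + \sum_(i <- l) x_i]. *)
Definition form := (nat * seq nat)%type.

Definition fval (f : form) (s : store) : nat := f.1 + sumn (map s f.2).

Inductive act := Asg of nat & form | Assert of form & form.

Definition put (s : store) (i v : nat) : store :=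
  fun k => if k == i then v else s k.

Definition astep (a : act) (s t : store) : Prop :=
  match a with
  | Asg i f => t = put s i (fval f s)
  | Assert f g => fval f s = fval g s /\ t = s
  end.

Inductive prog := Act of act | Seq of prog & prog | Star of prog.

Section ReflTransClosure.
Variables (T : Type) (r : T -> T -> Prop).

Inductive star : T -> T -> Prop :=
| star_refl x : star x x
| star_step x y z : r x y -> star y z -> star x z.

Lemma star_rcons x y z : star x y -> r y z -> star x z.
Proof.
elim=> {x y} [x|x y w rxy _ IH] ryz; last exact: star_step (rxy) (IH ryz).
exact: star_step ryz (star_refl _).
Qed.

Lemma star_invariant x y : star x y -> forall P : T -> Prop,
  (forall u v, P u -> r u v -> P v) -> P x -> P y.
Proof.
by move=> + P HP; elim=> {x y} // x y z rxy _ IH Px; apply: IH; exact: HP rxy.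
Qed.

End ReflTransClosure.

Fixpoint sem (P : prog) : store -> store -> Prop :=
  match P with
  | Act a => astep a
  | Seq P Q => fun s t => exists2 u, sem P s u & sem Q u t
  | Star P => star (sem P)
  end.

Definition agree (b o : nat) (s t : store) :=
  forall k, k < b -> k != o -> t k = s k.

(* Storage cells from [b] on are scratch space. *)
Definition computes (P : prog) (b o : nat) (s : store) (rel : nat -> Prop) :=
  (forall t, sem P s t -> agree b o s t /\ rel (t o)) /\
  (forall y, rel y -> exists2 t, sem P s t & t o = y).

Ltac cells := rewrite /put /=; repeat (case: eqP => ?); try lia.

(** * Basic loop programs: guessing, pairing, unpairing *)

Definition zero_p k := Act (Asg k (0, [::])).
Definition incr_p k := Act (Asg k (1, [:: k])).
Definition copy_p i o := Act (Asg o (0, [:: i])).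
Definition same_p i j := Act (Assert (0, [:: i]) (0, [:: j])).

(** Leaves an arbitrary number in cell [k]; later tests discard the runs with a wrong guess. *)
Definition guess_p k := Seq (zero_p k) (Star (incr_p k)).

Lemma guess_pP k b s : computes (guess_p k) b k s (fun=> True).
Proof.
split=> [t [u ->] run | y _].
  split=> //.
  apply: (star_invariant run (P := agree b k s)) => [v w av -> i ib ik|i ib ik].
    by rewrite /put (negPf ik); exact: av.
  by rewrite /put (negPf ik).
suff [t run ty] : exists2 t, star (sem (incr_p k)) (put s k 0) t & t k = y.
  by exists t => //; exists (put s k 0).
elim: y => [|y [t run ty]]; first by exists (put s k 0); [constructor|cells].
exists (put t k y.+1); last by cells.
by apply: star_rcons run _ => /=; rewrite /fval /= ty addn0.
Qed.

(** Affine assignments cannot multiply, so the triangular number is built by repeated addition: cell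
    [b] counts, cell [b.+1] holds [tri] of the count, and the test ends the loop at the right
    antidiagonal. *)
Definition pair_p i j o b :=
  Seq (zero_p b) (Seq (zero_p b.+1)
    (Seq (Star (Seq (incr_p b) (Act (Asg b.+1 (0, [:: b.+1; b])))))
      (Seq (Act (Assert (0, [:: b]) (0, [:: i; j])))
        (Act (Asg o (0, [:: b.+1; j])))))).

Lemma pair_pP i j o b s : i < b -> j < b -> o < b ->
  computes (pair_p i j o b) b o s (eq (cpair (s i) (s j))).
Proof.
move=> ib jb ob; rewrite /pair_p; set L := Star _; set s0 := put (put s b 0) b.+1 0.
have s0E k : k < b -> s0 k = s k by move=> kb; rewrite /s0; cells.
split.
  move=> t [? ->] [? ->]; rewrite -/s0 => -[u run [? [guard ->] ->]].
  have [au ub] : (forall k, k < b -> u k = s k) /\ u b.+1 = tri (u b).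
    move: u run {guard} => u run.
    pose P u := (forall k, k < b -> u k = s k) /\ u b.+1 = tri (u b).
    apply: (star_invariant run (P := P)) => [v w [av vb] [? -> ->]|]; last first.
      by split=> [k /s0E //|]; rewrite /s0; cells.
    split=> [k kb|]; first by cells; exact: av.
    by rewrite /fval /=; cells; rewrite add1n addn0 triS vb addn0 addnC; lia.
  split=> [k kb kn|]; first by rewrite /put (negPf kn) au.
  move: guard; rewrite /fval /= /put eqxx !(au i ib, au j jb) !addn0 !add0n => ubE.
  by rewrite ub ubE cpairE.
move=> _ <-.
have [u run [au [ub ub1]]] : exists2 u, sem L s0 u &
  (forall k, k < b -> u k = s k) /\ u b = s i + s j /\ u b.+1 = tri (s i + s j).
  elim: (s i + s j) => [|d [u run [au [ub ub1]]]].
    exists s0; first exact: star_refl.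
    by split=> //; rewrite /s0; split; cells.
  exists (put (put u b d.+1) b.+1 (tri d.+1)).
    apply: star_rcons run _; exists (put u b d.+1).
      by rewrite /= /fval /= ub addn0.
    rewrite /= /fval /=; congr put; cells.
    by rewrite triS ub1; lia.
  by split=> [k kb|]; [cells; exact: au|split; cells].
exists (put u o (cpair (s i) (s j))); last by cells.
do 2![eexists; first reflexivity]; exists u => //; exists u.
  by rewrite /= /fval /= !(au i ib, au j jb) ub !addn0.
by rewrite /= /fval /= ub1 au // !addn0.
Qed.

(** Inversion by guess and check: both components are guessed, paired again and compared with the
    input. *)
Definition unpair_p i b :=
  Seq (guess_p b) (Seq (guess_p b.+1)
    (Seq (pair_p b b.+1 b.+2 b.+3) (same_p b.+2 i))).

Lemma unpair_pP i b s : i < b ->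
  (forall t, sem (unpair_p i b) s t ->
     (forall k, k < b -> t k = s k) /\ s i = cpair (t b) (t b.+1)) /\
  (forall x y, s i = cpair x y ->
     exists2 t, sem (unpair_p i b) s t & t b = x /\ t b.+1 = y).
Proof.
move=> ib; have ltb : [/\ b < b.+3, b.+1 < b.+3 & b.+2 < b.+3] by split; lia.
case: ltb => b0 b1 b2; split.
  move=> t [u gu] [v gv] [w pw] [guard ->].
  have [au _] := (guess_pP b b.+3 s).1 _ gu.
  have [av _] := (guess_pP b.+1 b.+3 u).1 _ gv.
  have [aw pE] := (pair_pP v b0 b1 b2).1 _ pw.
  split=> [k kb|]; first by rewrite aw ?av ?au; lia.
  move: guard; rewrite /fval /= !addn0 !add0n -pE => wE.
  have <- : w i = s i by rewrite aw ?av ?au; lia.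
  by rewrite -wE !aw; lia.
move=> x y sE.
have [u gu ux] := (guess_pP b b.+3 s).2 x I.
have [au _] := (guess_pP b b.+3 s).1 _ gu.
have [v gv vy] := (guess_pP b.+1 b.+3 u).2 y I.
have [av _] := (guess_pP b.+1 b.+3 u).1 _ gv.
have [w pw wE] := (pair_pP v b0 b1 b2).2 _ erefl.
have [aw _] := (pair_pP v b0 b1 b2).1 _ pw.
have vx : v b = x by rewrite av ?ux; lia.
exists w; last by split; rewrite aw ?vx ?vy; lia.
exists u => //; exists v => //; exists w => //; split=> //.
rewrite /fval /= !addn0 !add0n wE vx vy -sE aw ?av ?au; lia.
Qed.

(** Input cell [i], output cell [o], scratch from [b] on. For [cRec], the cells from [b] to [b.+4]
    hold the parameter, the bound, the current value, the counter and the argument of [g]. For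
    [cMu], those from [b] to [b.+3] hold the candidate, the argument of [f], its value, and a
    guessed predecessor of that value, which certifies that it is nonzero. *)
Fixpoint compile (c : code) (i o b : nat) : prog :=
  match c with
  | cZero => zero_p o
  | cSucc => Act (Asg o (1, [:: i]))
  | cFst => Seq (unpair_p i b) (copy_p b o)
  | cSnd => Seq (unpair_p i b) (copy_p b.+1 o)
  | cPair f g => Seq (compile f i b b.+2)
      (Seq (compile g i b.+1 b.+2) (pair_p b b.+1 o b.+2))
  | cComp f g => Seq (compile g i b b.+1) (compile f b o b.+1)
  | cRec f g => Seq (unpair_p i b)
      (Seq (compile f b b.+2 b.+3) (Seq (zero_p b.+3)
        (Seq (Star (Seq (pair_p b.+3 b.+2 b.+4 b.+4.+1)
                (Seq (pair_p b b.+4 b.+4 b.+4.+1)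
                  (Seq (compile g b.+4 b.+2 b.+4.+1) (incr_p b.+3)))))
          (Seq (same_p b.+3 b.+1) (copy_p b.+2 o)))))
  | cMu f => Seq (zero_p b)
      (Seq (Star (Seq (pair_p i b b.+1 b.+4)
              (Seq (compile f b.+1 b.+2 b.+4) (Seq (guess_p b.+3)
                (Seq (Act (Assert (0, [:: b.+2]) (1, [:: b.+3]))) (incr_p b))))))
        (Seq (pair_p i b b.+1 b.+4)
          (Seq (compile f b.+1 b.+2 b.+4)
            (Seq (Act (Assert (0, [:: b.+2]) (0, [::]))) (copy_p b o)))))
  end.

Notation by_lia := ltac:(lia) (only parsing).

(** * Correctness of the compiler *)

Lemma agree_trans b o s t u :
  (forall k, k < b -> t k = s k) -> agree b o t u -> agree b o s u.
Proof. by move=> st tu k kb ko; rewrite tu ?st. Qed.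

Lemma put_agree b o s v : agree b o s (put s o v).
Proof. by move=> k _ /negPf ko; rewrite /put ko. Qed.

Lemma put_eq s o v : put s o v o = v.
Proof. by rewrite /put eqxx. Qed.

Lemma computes_sem P b o s rel y : computes P b o s rel -> rel y ->
  exists t, [/\ sem P s t, agree b o s t & t o = y].
Proof.
by move=> [sound compl] /compl[t run ty]; exists t; have [] := sound _ run.
Qed.

Section CompileRec.
Variables (f g : code).
Hypothesis IHf : forall i o b s, i < b -> o < b ->
  computes (compile f i o b) b o s (eval f (s i)).
Hypothesis IHg : forall i o b s, i < b -> o < b ->
  computes (compile g i o b) b o s (eval g (s i)).

Let body b := Seq (pair_p b.+3 b.+2 b.+4 b.+4.+1)
  (Seq (pair_p b b.+4 b.+4 b.+4.+1)
    (Seq (compile g b.+4 b.+2 b.+4.+1) (incr_p b.+3))).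

Lemma rec_body_sound b s t : sem (body b) s t ->
  [/\ forall k, k < b.+2 -> t k = s k, t b.+3 = (s b.+3).+1 &
      eval g (cpair (s b) (cpair (s b.+3) (s b.+2))) (t b.+2)].
Proof.
move=> [u pu [v pv [w gw ->]]].
have [au uE] := (@pair_pP b.+3 b.+2 b.+4 b.+4.+1 s by_lia by_lia by_lia).1 _ pu.
have [av vE] := (@pair_pP b b.+4 b.+4 b.+4.+1 u by_lia by_lia by_lia).1 _ pv.
have [aw wE] := (@IHg b.+4 b.+2 b.+4.+1 v by_lia by_lia).1 _ gw.
split=> [k kb||].
- by cells; rewrite aw ?av ?au; lia.
- by rewrite put_eq /fval /= aw ?av ?au; lia.
- have -> : put w b.+3 (fval (1, [:: b.+3]) w) b.+2 = w b.+2 by cells.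
  by rewrite uE -(au b) ?vE //; lia.
Qed.

Lemma rec_body_complete b s y :
  eval g (cpair (s b) (cpair (s b.+3) (s b.+2))) y ->
  exists2 t, sem (body b) s t & t b.+2 = y.
Proof.
move=> ey.
have [u [pu au uE]] :=
  computes_sem (@pair_pP b.+3 b.+2 b.+4 b.+4.+1 s by_lia by_lia by_lia) erefl.
have [v [pv av vE]] :=
  computes_sem (@pair_pP b b.+4 b.+4 b.+4.+1 u by_lia by_lia by_lia) erefl.
have [|w gw wE] := (@IHg b.+4 b.+2 b.+4.+1 v by_lia by_lia).2 y.
  by rewrite vE uE au //; lia.
exists (put w b.+3 (fval (1, [:: b.+3]) w)); last by rewrite -wE; cells.
by exists u => //; exists v => //; exists w.
Qed.

Lemma compile_recP i o b s : i < b -> o < b ->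
  computes (compile (cRec f g) i o b) b o s (eval (cRec f g) (s i)).
Proof.
move=> ib ob; have [usound ucompl] := unpair_pP s ib; split.
  move=> t [u /usound[au sE] [v fv [? -> [w run [? [guard ->] ->]]]]].
  have [av vE] := (@IHf b b.+2 b.+3 u by_lia by_lia).1 _ fv.
  pose P w := [/\ forall k, k < b.+2 -> w k = u k &
     eval (cRec f g) (cpair (u b) (w b.+3)) (w b.+2)].
  have [aw wE] : P w.
    apply: (star_invariant run (P := P)).
      move=> w1 w2 [aw1 e1] /rec_body_sound[aw2 n2 e2]; split.
        by move=> k kb; rewrite aw2 ?aw1.
      rewrite n2; apply: evRecS e1 _; rewrite -(aw1 b) //; lia.
    split=> [k kb|]; first by cells; apply: av; lia.
    rewrite put_eq; have -> : put v b.+3 (fval (0, [::]) v) b.+2 = v b.+2.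
      by cells.
    exact: evRec0.
  split=> [k kb ko|]; first by rewrite /put (negPf ko) aw ?au; lia.
  move: guard; rewrite put_eq /fval /= !addn0 !add0n => guard.
  by rewrite sE -(aw b.+1) // -guard.
move=> y ey; have [x [n sE]] : exists x n, s i = cpair x n.
  by case: (eval_RecI ey) => [[? ->]|[? [? [? [-> _ _]]]]]; do 2 eexists.
have [u pu [ux un]] := ucompl _ _ sE.
suff [w run [aw wn wy]] : exists2 w,
    sem (Seq (compile f b b.+2 b.+3) (Seq (zero_p b.+3) (Star (body b)))) u w &
    [/\ forall k, k < b.+2 -> w k = u k, w b.+3 = n & w b.+2 = y].
  case: run => v fv [v' zv' run].
  exists (put w o (fval (0, [:: b.+2]) w)).
    exists u => //; exists v => //; exists v' => //; exists w => //.
    exists w => //; split=> //.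
    by rewrite /fval /= wn aw ?un.
  by rewrite put_eq /fval /= wy add0n addn0.
move: ey; rewrite sE; elim: (n) y => [|m IHm] y.
  move=> /eval_Rec0I ey.
  have [|v [fv av vE]] := computes_sem (y := y) (@IHf b b.+2 b.+3 u by_lia by_lia).
    by rewrite ux.
  exists (put v b.+3 0).
    by exists v => //; exists (put v b.+3 0) => //; exact: star_refl.
  split=> [k kb||]; last by cells.
    by cells; rewrite av //; lia.
  by rewrite put_eq.
move=> /eval_RecSI[a ea ga]; have [w [v fv [v' zv' run]] [aw wm wa]] := IHm _ ea.
have [|t bt tE] := @rec_body_complete b w y; first by rewrite aw ?ux ?wm ?wa.
have [at1 tm _] := rec_body_sound bt.
exists t; last by split; rewrite ?tm ?wm // => k kb; rewrite at1 ?aw.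
by exists v => //; exists v' => //; exact: star_rcons run bt.
Qed.

Let mbody i b := Seq (pair_p i b b.+1 b.+4)
  (Seq (compile f b.+1 b.+2 b.+4) (Seq (guess_p b.+3)
    (Seq (Act (Assert (0, [:: b.+2]) (1, [:: b.+3]))) (incr_p b)))).

Lemma mu_test_sound i b s u v : i < b ->
  sem (pair_p i b b.+1 b.+4) s u -> sem (compile f b.+1 b.+2 b.+4) u v ->
  (forall k, k < b.+1 -> v k = s k) /\ eval f (cpair (s i) (s b)) (v b.+2).
Proof.
move=> ib pu fv.
have [au uE] := (@pair_pP i b b.+1 b.+4 s by_lia by_lia by_lia).1 _ pu.
have [av vE] := (@IHf b.+1 b.+2 b.+4 u by_lia by_lia).1 _ fv.
by split=> [k kb|]; [rewrite av ?au; lia | rewrite uE].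
Qed.

Lemma mu_test_complete i b s y : i < b -> eval f (cpair (s i) (s b)) y ->
  exists u v, [/\ sem (pair_p i b b.+1 b.+4) s u,
     sem (compile f b.+1 b.+2 b.+4) u v & v b.+2 = y].
Proof.
move=> ib ey.
have [u [pu au uE]] :=
  computes_sem (@pair_pP i b b.+1 b.+4 s by_lia by_lia by_lia) erefl.
have [|v fv vE] := (@IHf b.+1 b.+2 b.+4 u by_lia by_lia).2 y.
  by rewrite uE.
by exists u, v.
Qed.

Lemma compile_muP i o b s : i < b -> o < b ->
  computes (compile (cMu f) i o b) b o s (eval (cMu f) (s i)).
Proof.
move=> ib ob; split.
  move=> t [? -> [w run [u pu [v fv [? [guard ->] ->]]]]].
  pose P w := (forall k, k < b -> w k = s k) /\
     forall m, m < w b -> exists v, eval f (cpair (s i) m) v.+1.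
  have [aw wE] : P w.
    apply: (star_invariant run (P := P)); last first.
      by split=> [k kb|m]; rewrite ?put_eq //; cells.
    move=> w1 w2 [aw1 e1] [u1 pu1 [v1 fv1 [v2 gv2 [v3 [guard1 ->] ->]]]].
    have [av1 ev1] := mu_test_sound ib pu1 fv1.
    have [av2 _] := (guess_pP b.+3 b.+4 v1).1 _ gv2.
    have v2b : v2 b = w1 b by rewrite av2 ?av1; lia.
    split=> [k kb|m]; first by cells; rewrite av2 ?av1 ?aw1; lia.
    rewrite put_eq /fval /= addn0 v2b add1n ltnS leq_eqVlt.
    case/orP=> [/eqP ->|]; last exact: e1.
    (* [m] is here the candidate just tested, and the guessed cell [b.+3] exhibits its value as a
       successor. *)
    move: guard1; rewrite /fval /= !addn0 add0n add1n av2; try lia.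
    by move=> v1E; exists (v2 b.+3); rewrite -v1E -(aw1 i).
  have [av ev] := mu_test_sound ib pu fv.
  split=> [k kb ko|]; first by rewrite /put (negPf ko) av ?aw; lia.
  move: guard; rewrite put_eq /fval /= !addn0 !add0n => v0.
  rewrite av //; apply: evMu => //.
  by rewrite -(aw i) // -v0.
move=> n /eval_MuI[f0 fS].
suff [w run [aw wn]] : exists2 w, star (sem (mbody i b)) (put s b 0) w &
    (forall k, k < b -> w k = s k) /\ w b = n.
  have [|u [v [pu fv v0]]] := @mu_test_complete i b w 0 ib.
    by rewrite aw ?wn.
  have [av _] := mu_test_sound ib pu fv.
  exists (put v o (fval (0, [:: b]) v)).
    exists (put s b 0) => //; exists w => //; exists u => //; exists v => //.
    by exists v => //; split=> //; rewrite /fval /= v0.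
  by rewrite put_eq /fval /= av // wn addn0.
elim: n fS {f0} => [|n IHn] fS.
  exists (put s b 0); first exact: star_refl.
  by split=> [k kb|]; cells.
have [m mn|w run [aw wn]] := IHn; first by apply: fS; lia.
have [y ey] := fS n (leqnn _).
have [|u [v [pu fv vy]]] := @mu_test_complete i b w y.+1 ib.
  by rewrite aw ?wn.
have [av _] := mu_test_sound ib pu fv.
have [v2 [gv2 av2 v2y]] := computes_sem (guess_pP b.+3 b.+4 v) (y := y) I.
have v2b : v2 b = n by rewrite av2 ?av ?wn; lia.
exists (put v2 b n.+1).
  apply: star_rcons run _; exists u => //; exists v => //; exists v2 => //.
  exists v2; first by split=> //; rewrite /fval /= v2y av2 ?vy; lia.
  by rewrite /= /fval /= v2b addn0.
by split=> [k kb|]; [cells; rewrite av2 ?av ?aw; lia | rewrite put_eq].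
Qed.

End CompileRec.

(** The relation may be empty: divergence of [c] shows up as the absence of a complete run. *)
Lemma compileP c i o b s : i < b -> o < b ->
  computes (compile c i o b) b o s (eval c (s i)).
Proof.
elim: c i o b s => [||||f IHf g IHg|f IHf g IHg|f IHf g IHg|f IHf] i o b s ib ob.
- split=> [t ->|y ey]; first by split; [exact: put_agree|rewrite put_eq; constructor].
  by exists (put s o 0); [|rewrite put_eq; inversion ey].
- split=> [t ->|y ey].
    split; first exact: put_agree.
    by rewrite put_eq /fval /= addn0; constructor.
  exists (put s o (s i).+1); first by rewrite /= /fval /= addn0.
  by rewrite put_eq; inversion ey.
- have [sound compl] := unpair_pP s ib; split.
    move=> t [u /sound[au sE] ->]; split.
      exact: agree_trans au (@put_agree _ _ _ _).
    by rewrite put_eq sE /fval /= addn0; constructor.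
  move=> y /eval_FstI[z /compl[u pu [uy _]]].
  exists (put u o (fval (0, [:: b]) u)); first by exists u.
  by rewrite put_eq /fval /= addn0.
- have [sound compl] := unpair_pP s ib; split.
    move=> t [u /sound[au sE] ->]; split.
      exact: agree_trans au (@put_agree _ _ _ _).
    by rewrite put_eq sE /fval /= addn0; constructor.
  move=> y /eval_SndI[z /compl[u pu [_ uy]]].
  exists (put u o (fval (0, [:: b.+1]) u)); first by exists u.
  by rewrite put_eq /fval /= addn0.
- split=> [t [u fu [v gv pt]]|y /eval_PairI[x [z [fx gz ->]]]].
    have [au uE] := (IHf i b b.+2 s by_lia by_lia).1 _ fu.
    have [av vE] := (IHg i b.+1 b.+2 u by_lia by_lia).1 _ gv.
    have [at1 tE] := (@pair_pP b b.+1 o b.+2 v by_lia by_lia by_lia).1 _ pt.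
    split=> [k kb ko|]; first by rewrite at1 ?av ?au; lia.
    rewrite -tE; apply: evPair; first by rewrite av //; lia.
    by rewrite -(au i) //; lia.
  have [u [fu au uE]] := computes_sem (IHf i b b.+2 s by_lia by_lia) fx.
  have [|v [gv av vE]] := computes_sem (IHg i b.+1 b.+2 u by_lia by_lia) (y := z).
    by rewrite au //; lia.
  have [t [pt _ tE]] :=
    computes_sem (@pair_pP b b.+1 o b.+2 v by_lia by_lia by_lia) erefl.
  exists t; first by exists u => //; exists v.
  by rewrite tE vE av ?uE //; lia.
- split=> [t [u gu ft]|y /eval_CompI[z gz fz]].
    have [au uE] := (IHg i b b.+1 s by_lia by_lia).1 _ gu.
    have [at1 tE] := (IHf b o b.+1 u by_lia by_lia).1 _ ft.
    split=> [k kb ko|]; first by rewrite at1 ?au; lia.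
    exact: evComp uE tE.
  have [u [gu au uE]] := computes_sem (IHg i b b.+1 s by_lia by_lia) gz.
  have [|t [ft _ tE]] := computes_sem (IHf b o b.+1 u by_lia by_lia) (y := y).
    by rewrite uE.
  by exists t => //; exists u.
- exact: compile_recP.
- exact: compile_muP.
Qed.

(** * Control flow graphs of loop programs *)

Lemma In_cat (T : Type) (x : T) s1 s2 :
  List.In x (s1 ++ s2) <-> List.In x s1 \/ List.In x s2.
Proof. by elim: s1 => [|y s1 IHs] /=; [tauto|rewrite IHs; tauto]. Qed.

Definition edge := (nat * act * nat)%type.

Definition skip := Assert (0, [::]) (0, [::]).

Fixpoint plen (P : prog) : nat :=
  match P with
  | Act _ => 1
  | Seq P Q => plen P + plen Q
  | Star P => (plen P).+2
  end.

(* Control flow graph of [P], with entry [l] and exit [l + plen P]. *)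
Fixpoint flow (P : prog) (l : nat) : seq edge :=
  match P with
  | Act a => [:: (l, a, l.+1)]
  | Seq P Q => flow P l ++ flow Q (l + plen P)
  | Star P => [:: (l, skip, l.+1); (l.+1 + plen P, skip, l.+1);
                  (l.+1, skip, (l.+1 + plen P).+1)] ++ flow P l.+1
  end.

Inductive epath (E : edge -> Prop) : nat -> store -> nat -> store -> Prop :=
| epath_nil p s : epath E p s p s
| epath_cons p a q s t p' s' : E (p, a, q) -> astep a s t ->
    epath E q t p' s' -> epath E p s p' s'.

Lemma epath_sub (E E' : edge -> Prop) p s q t : (forall e, E e -> E' e) ->
  epath E p s q t -> epath E' p s q t.
Proof.
move=> sub; elim=> {p s q t} [p s|p a q s t p' s' /sub pq st _ IH].
  exact: epath_nil.
exact: epath_cons pq st IH.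
Qed.

Lemma epath_cat E p s q t r u :
  epath E p s q t -> epath E q t r u -> epath E p s r u.
Proof.
by elim=> {p s q t} // p a q s t p' s' pq st _ IH /IH; exact: epath_cons pq st.
Qed.

Lemma epath1 (E : edge -> Prop) p a q s t :
  E (p, a, q) -> astep a s t -> epath E p s q t.
Proof. by move=> e st; exact: epath_cons e st (epath_nil _ _ _). Qed.

Lemma epath_inv E p s n t : epath E p s n t ->
  p = n /\ s = t \/
  exists a q u, [/\ E (p, a, q), astep a s u & epath E q u n t].
Proof. by case=> [? ?|? a q ? u *]; [left|right; exists a, q, u]. Qed.

Lemma plen_gt0 P : 0 < plen P.
Proof. by elim: P => //= P IHP Q IHQ; rewrite addn_gt0 IHP. Qed.

Definition inflow P l : edge -> Prop := fun e => List.In e (flow P l).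

Lemma inflow_bound P l p a q : inflow P l (p, a, q) ->
  l <= p < l + plen P /\ l < q <= l + plen P.
Proof.
rewrite /inflow; elim: P l => [b|P IHP Q IHQ|P IHP] l /=.
- by case=> // -[<- _ <-]; lia.
- by case/In_cat=> [/IHP|/IHQ]; lia.
- have := plen_gt0 P => P0.
  by case=> [[<- _ <-]|[[<- _ <-]|[[<- _ <-]|/IHP]]]; lia.
Qed.

Lemma skip_step s : astep skip s s.
Proof. by []. Qed.

Lemma flow_complete P l s t : sem P s t ->
  epath (inflow P l) l s (l + plen P) t.
Proof.
elim: P l s t => [a|P IHP Q IHQ|P IHP] l s t /=.
- by move=> st; rewrite addn1; apply: epath1 st; left.
- case=> u /(IHP l) su /(IHQ (l + plen P)) ut; rewrite addnA.
  apply: (@epath_cat _ _ _ (l + plen P) u).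
    by apply: epath_sub su => e eP; apply/In_cat; left.
  by apply: epath_sub ut => e eQ; apply/In_cat; right.
- move=> run; apply: (@epath_cat _ _ _ l.+1 s).
    by apply: epath1 (skip_step _); left.
  elim: run => {s t} [s|s u t /(IHP l.+1) su _ IH].
    have -> : l + (plen P).+2 = (l.+1 + plen P).+1 by lia.
    by apply: epath1 (skip_step _); right; right; left.
  apply: (@epath_cat _ _ _ (l.+1 + plen P) u).
    by apply: epath_sub su => e eP; do 3!right.
  by apply: epath_cons (skip_step _) IH; right; left.
Qed.

(** Edges of [E1] start below [m] and end at most at [m], while edges of [E2] stay at or above [m].
    A path therefore passes from the first graph to the second only at [m], and never returns. *)
Lemma epath_seq (E1 E2 : edge -> Prop) m p s n t :
  (forall p a q, E1 (p, a, q) -> p < m /\ q <= m) ->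
  (forall p a q, E2 (p, a, q) -> m <= p /\ m <= q) ->
  m <= n -> epath (fun e => E1 e \/ E2 e) p s n t ->
  (m <= p -> epath E2 p s n t) /\
  (p < m -> exists2 u, epath E1 p s m u & epath E2 m u n t).
Proof.
move=> b1 b2 mn run; elim: run mn => {p s n t} [p s mp|p a q s t n u pq st _ IH mn].
  by split=> [_|]; [exact: epath_nil|lia].
have [IH1 IH2] := IH mn.
case: pq => e; [have := b1 _ _ _ e|have := b2 _ _ _ e] => -[pm qm]; split; try lia.
  move=> _; case: (ltngtP q m) qm => // [/IH2[v qv vn]|qE] _.
    by exists v => //; exact: epath_cons e st qv.
  exists t; first by rewrite -qE; exact: epath1 e st.
  by rewrite -qE; apply: IH1; lia.
by move=> _; exact: epath_cons e st (IH1 qm).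
Qed.

(** Body edges neither enter the loop head [h] nor leave [n], so the part of a path between two
    visits of [h] is one iteration followed by the edge from [n] to [h]. The third alternative first
    completes the iteration in progress at [p]. The equation on [x] keeps the endpoint a variable
    during the induction. *)
Lemma epath_star (E : edge -> Prop) l h n x p s t : x = n.+1 ->
  (forall p a q, E (p, a, q) -> h <= p < n /\ h < q <= n) -> l < h -> h < n ->
  epath (fun e => [\/ e = (l, skip, h), e = (n, skip, h),
                     e = (h, skip, n.+1) | E e]) p s x t -> h <= p ->
  [\/ s = t /\ p = n.+1, s = t /\ p = h |
     exists2 u, epath E p s n u & star (fun a b => epath E h a n b) u t].
Proof.
move=> def_x bE lh hn run.
elim: run def_x => {p s x t} [p s def_x _|p a q s t x u pq st _ IH def_x hp].
  by constructor 1.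
have {}IH := IH def_x; case: pq => [[pE _ _]|[pE aE qE]|[pE aE qE]|e].
- by move: hp; rewrite pE; lia.
- subst; move: st => [_ ts]; subst t.
  case: (IH (leqnn _)) => [[su]|[su _]|[v sv vu]]; first by lia.
    by subst u; constructor 3; exists s; [exact: epath_nil|exact: star_refl].
  by constructor 3; exists s; [exact: epath_nil|exact: star_step sv vu].
- subst; move: st => [_ ts]; subst t.
  case: (IH by_lia).
  + by case=> su _; constructor 2.
  + by case=> _; lia.
  + case=> v sv; inversion sv as [|? b r ? w ? ? e]; subst; first by lia.
    by have := bE _ _ _ e; lia.
- have := bE _ _ _ e => bpq; case: (IH by_lia).
  + by case=> _; lia.
  + by case=> _; lia.
  + by case=> v qv vu; constructor 3; exists v => //; exact: epath_cons e st qv.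
Qed.

Lemma flow_sound P l s t :
  epath (inflow P l) l s (l + plen P) t -> sem P s t.
Proof.
elim: P l s t => [a|P IHP Q IHQ|P IHP] l s t /=.
- rewrite addn1 => /epath_inv[[]|[b [q [u [e su /epath_inv run]]]]]; first by lia.
  case: e su run => // -[<- <-] su [[_ <-] //|[c [r [v [[]// + _ _]]]]].
  by case; lia.
- rewrite addnA => run; have P0 := plen_gt0 P.
  have [||||_] := @epath_seq (inflow P l) (inflow Q (l + plen P)) (l + plen P) l s
      (l + plen P + plen Q) t.
  + by move=> p a q /inflow_bound; lia.
  + by move=> p a q /inflow_bound; lia.
  + by lia.
  + by apply: epath_sub run => e /In_cat.
  + by case=> [|u /IHP su /IHQ ut]; [lia | exists u].
- have P0 := plen_gt0 P; set n := l.+1 + plen P.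
  have -> : l + (plen P).+2 = n.+1 by lia.
  move=> run; have {}run : epath (inflow (Star P) l) l.+1 s n.+1 t.
    case/epath_inv: run => [[]|[b [q [u [e su run]]]]]; first by lia.
    case: e su run => [[<- <-] [_ ->] //|].
    by case=> [[]|[[]|/inflow_bound]]; lia.
  case: (@epath_star (inflow P l.+1) l l.+1 n n.+1 l.+1 s t) => //; try lia.
  + by move=> p a q /inflow_bound.
  + apply: epath_sub run => e [<-|[<-|[<-|]]]; first by constructor 1.
    * by constructor 2.
    * by constructor 3.
    * by constructor 4.
  + by case=> -> _; exact: star_refl.
  + case=> u /IHP su ut; apply: star_step su _.
    elim: ut => {s u t run} [s|s u t /IHP su _ IH]; first exact: star_refl.
    exact: star_step su IH.
Qed.

Lemma flowP P s t : epath (inflow P 0) 0 s (plen P) t <-> sem P s t.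
Proof. by split=> [/flow_sound|/(flow_complete 0)]. Qed.

Definition input_store (x : nat) : store := fun k => if k == 0 then x else 0.

Definition halting_prog (c : code) : prog := compile c 0 1 2.

Lemma halting_progP c x :
  (exists y, eval c x y) <->
  exists t, epath (inflow (halting_prog c) 0) 0 (input_store x)
                  (plen (halting_prog c)) t.
Proof.
have [sound compl] := @compileP c 0 1 2 (input_store x) isT isT.
split=> [[y /compl[t run _]]|[t /flowP run]]; first by exists t; apply/flowP.
by exists (t 1); have [] := sound _ run.
Qed.

(** * Tests as a comparison of quadratic costs *)

(* Machine variables: [0] is the program counter, [1] is constantly one, and
   [k.+2] is the storage cell [k]. *)
Definition cfg (pc : nat) (s : store) : nat -> nat :=
  fun k => match k with 0 => pc | 1 => 1 | k'.+2 => s k' end.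

(** A linear form is a list of variables with repetitions; its coefficients are the values of
    [count_mem]. *)
Definition lval (l : seq nat) (v : nat -> nat) : nat := sumn (map v l).

(** Constants become multiples of variable [1], which makes affine forms linear. *)
Definition mform (f : form) : seq nat := nseq f.1 1 ++ map (addn 2) f.2.

Lemma lval_nseq1 n pc s : lval (nseq n 1) (cfg pc s) = n.
Proof. by rewrite /lval map_nseq sumn_nseq mul1n. Qed.

Lemma lval_mform f pc s : lval (mform f) (cfg pc s) = fval f s.
Proof.
rewrite /lval /mform map_cat sumn_cat -/(lval _ _) lval_nseq1.
by rewrite /fval -map_comp.
Qed.

Definition guard := (seq nat * seq nat)%type.

Definition pc_guard (p : nat) : guard := ([:: 0], nseq p 1).

(** Letters may come in any order; the test of the program counter forces accepted words to follow
    paths of the graph. *)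
Definition guards (e : edge) : seq guard :=
  let: (p, a, q) := e in
  pc_guard p :: (if a is Assert f g then [:: (mform f, mform g)] else [::]).

Definition mupd (e : edge) (k : nat) : seq nat :=
  let: (p, a, q) := e in
  if k == 0 then nseq q 1 else
  if a is Asg i f then (if k == i.+2 then mform f else [:: k]) else [:: k].

Definition mstep (e : edge) (v : nat -> nat) : nat -> nat :=
  fun k => lval (mupd e k) v.

Definition passes (gs : seq guard) (v : nat -> nat) : bool :=
  all (fun g => lval g.1 v == lval g.2 v) gs.

Lemma mstep_cfg p a q pc s t : astep a s t ->
  mstep (p, a, q) (cfg pc s) = cfg q t.
Proof.
move=> st; apply: funext => -[|[|k]]; rewrite /mstep /=.
- exact: lval_nseq1.
- by case: a st => [i f|f g] _; rewrite /lval.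
- case: a st => [i f ->|f g [_ ->]]; last by rewrite /lval /= addn0.
  rewrite /put !eqSS; case: eqP => _; first exact: lval_mform.
  by rewrite /lval /= addn0.
Qed.

Lemma passes_pc p pc s : passes [:: pc_guard p] (cfg pc s) = (pc == p).
Proof. by rewrite /passes /= lval_nseq1 /lval /= addn0 andbT. Qed.

Lemma passes_guards p a q pc s :
  passes (guards (p, a, q)) (cfg pc s) <-> pc = p /\ exists t, astep a s t.
Proof.
rewrite /passes /= lval_nseq1 /lval /= addn0; split.
  case/andP=> /eqP -> pa; split=> //; case: a pa => [i f|f g] /=.
    by eexists.
  by rewrite andbT -!/(lval _ _) !lval_mform => /eqP; exists s.
case=> -> [t st]; rewrite eqxx; case: a st => //= f g [fg _].
by rewrite -!/(lval _ _) !lval_mform fg eqxx.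
Qed.

(* The two sides of [2 L R <= L^2 + R^2], which are equal iff the test
   [L = R] passes. *)
Definition gcost (b : bool) (gs : seq guard) (v : nat -> nat) : nat :=
  \sum_(g <- gs) (if b then lval g.1 v ^ 2 + lval g.2 v ^ 2
                  else 2 * (lval g.1 v * lval g.2 v)).

Lemma gcost_pass gs v : passes gs v -> gcost false gs v = gcost true gs v.
Proof.
rewrite /gcost; elim: gs => [|g gs IH] /=; first by rewrite !big_nil.
by case/andP=> /eqP eqg /IH; rewrite !big_cons eqg => ->; lia.
Qed.

Lemma gcost_leq gs v : gcost false gs v <= gcost true gs v.
Proof. by apply: leq_sum => g _; exact: nat_Cauchy. Qed.

Lemma gcost_fail gs v : ~~ passes gs v -> gcost false gs v < gcost true gs v.
Proof.
elim: gs => [//|g gs IH] /=; rewrite negb_and /gcost !big_cons -!/(gcost _ _ _).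
case/orP=> [ne|/IH lt]; last first.
  by rewrite -addnS; apply: leq_add => //; exact: nat_Cauchy.
rewrite -addSn; apply: leq_add; last exact: gcost_leq.
by rewrite (ltn_leqif (nat_Cauchy _ _)).
Qed.

Definition form_ok (r : nat) (f : form) := all (fun k => k.+2 < r) f.2.

Definition edge_ok (r : nat) (e : edge) : bool :=
  match e.1.2 with
  | Asg _ f => form_ok r f
  | Assert f g => form_ok r f && form_ok r g
  end.

Lemma mform_ok r f : 2 < r -> form_ok r f -> all (gtn r) (mform f).
Proof.
move=> r2 okf; rewrite all_cat all_map; apply/andP; split.
  by apply/allP => k; rewrite mem_nseq => /andP[_ /eqP ->] /=; lia.
exact: okf.
Qed.

Definition guard_ok (r : nat) (g : guard) := all (gtn r) g.1 && all (gtn r) g.2.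

Lemma pc_guard_ok r p : 2 < r -> guard_ok r (pc_guard p).
Proof.
move=> r2; apply/andP; split => /=; first by rewrite andbT; lia.
by apply/allP => k; rewrite mem_nseq => /andP[_ /eqP ->] /=; lia.
Qed.

Lemma guards_ok r e : 2 < r -> edge_ok r e -> all (guard_ok r) (guards e).
Proof.
case: e => -[p a] q r2; rewrite /edge_ok /= pc_guard_ok //=.
by case: a => //= f g /andP[okf okg]; rewrite /guard_ok !mform_ok.
Qed.

Lemma mupd_ok r e k : 2 < r -> edge_ok r e -> k < r -> all (gtn r) (mupd e k).
Proof.
case: e => -[p a] q r2; rewrite /edge_ok /= => oke kr.
case: eqP => _.
  by apply/allP => i; rewrite mem_nseq => /andP[_ /eqP ->] /=; lia.
case: a oke => [i f okf|f g _] /=; last by rewrite kr.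
by case: eqP => _; [exact: mform_ok | rewrite /= kr].
Qed.

Lemma form_ok_bound f : exists r, forall r', r <= r' -> form_ok r' f.
Proof.
case: f => c l; rewrite /form_ok /=; elim: l => [|k l [r IH]]; first by exists 0.
exists (maxn k.+3 r) => r'; rewrite geq_max => /andP[kr /IH].
by rewrite /= kr.
Qed.

Lemma edges_ok_bound (E : seq edge) :
  exists2 r, 2 < r & forall e, List.In e E -> edge_ok r e.
Proof.
suff [r okr] : exists r, forall r', r <= r' -> forall e, List.In e E -> edge_ok r' e.
  by exists (r + 3); [lia | apply: okr; lia].
elim: E => [|e E [r IH]]; first by exists 0.
have [r1 okr1] : exists r, forall r', r <= r' -> edge_ok r' e.
  rewrite /edge_ok; case: (e.1.2) => [_ f|f g]; first exact: form_ok_bound.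
  have [[rf okf] [rg okg]] := (form_ok_bound f, form_ok_bound g).
  exists (maxn rf rg) => r'; rewrite geq_max => /andP[/okf -> /okg ->] //.
exists (maxn r r1) => r'; rewrite geq_max => /andP[/IH okE /okr1 oke] e' /=.
by case=> [<-|/okE].
Qed.

(** * The labelled Markov chain of a program *)

(** A run reads [Lstart], [Linit] and one [Lcmd] per edge; then [Lcont] returns to the root for
    another run, or [Lstop] ends the word. [Lmix] is the first letter read from a mixture. *)
Inductive letter := Lstart | Linit | Lcont | Lstop | Lmix | Lcmd of edge.

(* [Vec b i j] carries the product of the machine variables [i] and [j], and
   [Acc b] the accumulated value of [gcost b]; [Root false] and [Root true] are
   the states to be compared, and [Mix b] starts a mixture of them. *)
Inductive state :=
| Root of bool | Ini of bool & nat | Mix of bool | Fin | Dead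
| Acc of bool | Vec of bool & nat & nat.

Definition is_fin (p : state) : bool := if p is Fin then true else false.

(** The coefficient of [v_i v_j] in the quadratic form [gcost b gs], summed over ordered pairs. *)
Definition gweight (b : bool) (gs : seq guard) (i j : nat) : nat :=
  \sum_(g <- gs)
    (if b then count_mem i g.1 * count_mem j g.1 + count_mem i g.2 * count_mem j g.2
     else 2 * (count_mem i g.1 * count_mem j g.2)).

Section Chain.
Variables (E : seq edge) (fin r x : nat).

(* The extra one that [Root false] gets decides between [gcost false] and
   [gcost true]. *)
Definition end_weight (b : bool) (i j : nat) : nat :=
  gweight b [:: pc_guard fin] i j + [&& ~~ b, i == 1 & j == 1].

(** At the start only the variables [1] and [2] are possibly nonzero, with values one and [x]. The
    index [n] selects the products equal to [x^2], to [x] and to one. *)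
Definition init_weight (n i j : nat) : nat :=
  match n with
  | 0 => (i == 2) && (j == 2)
  | 1 => ((i == 1) && (j == 2)) || ((i == 2) && (j == 1))
  | _ => (i == 1) && (j == 1)
  end.

(** Natural weights before the division by [scale]. The weight from [Vec b i j] to [Vec b k l] is
    the coefficient of [v_i v_j] in the product of the updated variables [k] and [l]. *)
Definition iw (a : letter) (p q : state) : nat :=
  match a, p, q with
  | Linit, Ini b n, Vec b' i j => (b == b') * init_weight n i j
  | Lcont, Acc b, Root b' => b == b'
  | Lcont, Vec b i j, Root b' => (b == b') * end_weight b i j
  | Lstop, Acc b, Fin => 1
  | Lstop, Vec b i j, Fin => end_weight b i j
  | Lcmd e, Acc b, Acc b' => b == b'
  | Lcmd e, Vec b i j, Acc b' => (b == b') * gweight b (guards e) i j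
  | Lcmd e, Vec b i j, Vec b' k l =>
      (b == b') * (count_mem i (mupd e k) * count_mem j (mupd e l))
  | _, _, _ => 0
  end.

Definition pairs : seq (nat * nat) :=
  [seq (i, j) | i <- iota 0 r, j <- iota 0 r].

Definition vecs (b : bool) : seq state := [seq Vec b ij.1 ij.2 | ij <- pairs].

Definition states : seq state :=
  [:: Root false; Root true; Ini false 0; Ini false 1; Ini false 2;
      Ini true 0; Ini true 1; Ini true 2; Mix false; Mix true;
      Fin; Dead; Acc false; Acc true] ++ vecs false ++ vecs true.

Definition letters : seq letter :=
  [:: Lstart; Linit; Lcont; Lstop; Lmix] ++ map Lcmd E.

Definition row_total (p : state) : nat :=
  \sum_(q <- states) \sum_(a <- letters) iw a p q.

(** A single constant above all row totals, so that both sums to be compared are scaled alike. *)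
Definition scale : nat := (\sum_(p <- states) row_total p).+1.

Local Open Scope ring_scope.

(** With this denominator the three start weights sum to one and are reduced fractions, so that
    their encodings can be computed from [x] without a gcd. *)
Definition denom : nat := (x * x + x + 1)%N.

Definition start_weight (n : nat) : rat :=
  match n with
  | 0%N => (x * x)%:R / denom%:R
  | 1%N => x%:R / denom%:R
  | _ => 1 / denom%:R
  end.

(** Whatever the root weights, the first mixture is at most [(1/2) / (1/32) = 16] times the second,
    and the second at most [(31/32) / (1/2) < 2] times the first. The former ratio approaches [16]
    as [Root false] dominates, and is at most one when [Root true] does. *)
Definition mix_weight (b b' : bool) : rat :=
  if b then (if b' then 31 / 32 else 1 / 32) else 1 / 2.

(** The mass that a row lacks goes to [Dead], which loops forever and gives every word weight
    zero. *)
Definition wt (a : letter) (p q : state) : rat :=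
  match p with
  | Fin => 0
  | Root b =>
      match a, q with
      | Lstart, Ini b' n => if b == b' then start_weight n else 0
      | _, _ => 0
      end
  | Mix b => match a, q with Lmix, Root b' => mix_weight b b' | _, _ => 0 end
  | _ => (iw a p q)%:R / scale%:R +
      match a, q with Linit, Dead => 1 - (row_total p)%:R / scale%:R | _, _ => 0 end
  end.

Definition chain : WA :=
  MkWA (size states) (size letters)
    [seq [seq [seq wt a p q | q <- states] | p <- states] | a <- letters]
    (map is_fin states).

(** Word weights by recursion over lists, free of ordinals and matrices; [nu_chain] identifies them
    with [nu]. *)
Fixpoint wval (p : state) (w : seq letter) : rat :=
  if w is a :: w' then \sum_(q <- states) wt a p q * wval q w'
  else (is_fin p)%:R.

Definition ordinary (p : state) : bool :=
  match p with Fin | Root _ | Mix _ => false | _ => true end.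

Lemma wt_ordinary a p q : ordinary p -> wt a p q = (iw a p q)%:R / scale%:R +
  match a, q with Linit, Dead => 1 - (row_total p)%:R / scale%:R | _, _ => 0 end.
Proof. by case: p. Qed.

Lemma scale_neq0 : scale%:R != 0 :> rat.
Proof. by rewrite pnatr_eq0. Qed.

Lemma denom_neq0 : denom%:R != 0 :> rat.
Proof. by rewrite pnatr_eq0 /denom addn1. Qed.

Lemma denomE : denom%:R = (x * x)%:R + x%:R + 1 :> rat.
Proof. by rewrite /denom !natrD. Qed.

Lemma big_states (F : state -> rat) : \sum_(q <- states) F q =
  F (Root false) + F (Root true) + F (Ini false 0) + F (Ini false 1) +
  F (Ini false 2) + F (Ini true 0) + F (Ini true 1) + F (Ini true 2) +
  F (Mix false) + F (Mix true) + F Fin + F Dead + F (Acc false) + F (Acc true) +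
  \sum_(ij <- pairs) F (Vec false ij.1 ij.2) +
  \sum_(ij <- pairs) F (Vec true ij.1 ij.2).
Proof. by rewrite !big_cat !big_cons big_nil !big_map /= addr0 !addrA. Qed.

Lemma big_letters (F : letter -> rat) : \sum_(a <- letters) F a =
  F Lstart + F Linit + F Lcont + F Lstop + F Lmix + \sum_(e <- E) F (Lcmd e).
Proof. by rewrite big_cat !big_cons big_nil big_map /= addr0 !addrA. Qed.

Lemma row_sum p : ~~ is_fin p ->
  \sum_(q <- states) \sum_(a <- letters) wt a p q = 1.
Proof.
move=> nfin; have [op|] := boolP (ordinary p).
  under eq_bigr => q _ do under eq_bigr => a _ do rewrite (wt_ordinary _ _ op).
  under eq_bigr => q _ do rewrite big_split /= -mulr_suml -natr_sum.
  rewrite big_split /= -mulr_suml -natr_sum -/(row_total p).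
  rewrite [X in _ + X](_ : _ = 1 - (row_total p)%:R / scale%:R); last first.
    by rewrite big_states !big_letters !(big1_eq, addr0, add0r).
  by rewrite addrC subrK.
have vec0 c : ~~ ordinary p ->
    \sum_(ij <- pairs) \sum_(a <- letters) wt a p (Vec c ij.1 ij.2) = 0.
  move=> np; rewrite big1 // => ij _.
  by rewrite big_letters; case: p nfin np => //= b _ _; rewrite big1_eq !addr0.
move=> np; rewrite big_states !vec0 // !big_letters.
have D0 := denom_neq0; case: p nfin np {vec0} => // -[] _ _ /=;
  rewrite !(big1_eq, addr0, add0r).
- by rewrite -!mulrDl -denomE divff.
- by rewrite -!mulrDl -denomE divff.
- by rewrite -mulrDl addrC natr1 divff.
- by rewrite -splitr.
Qed.

Lemma wval_Dead w : wval Dead w = 0.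
Proof.
elim: w => //= a w IHw; rewrite big_states IHw mulr0 !big1 => [|ij _|ij _].
- by rewrite /wt /=; case: a => [||||| ?]; rewrite !(mul0r, addr0).
- by rewrite /wt /=; case: a => [||||| ?]; rewrite !(mul0r, addr0).
- by rewrite /wt /=; case: a => [||||| ?]; rewrite !(mul0r, addr0).
Qed.

(** The mass sent to [Dead] is lost, so only the natural weights remain visible. *)
Lemma wval_ordinary a p w : ordinary p ->
  wval p (a :: w) = (\sum_(q <- states) (iw a p q)%:R * wval q w) / scale%:R.
Proof.
move=> op /=; rewrite mulr_suml.
under eq_bigr => q _ do rewrite (wt_ordinary _ _ op).
apply: eq_bigr => q _; rewrite mulrDl mulrAC -[RHS]addr0; congr (_ + _).
case: a => [||||| ?]; rewrite ?mul0r //.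
by case: q => [?|? ?|?|||?|? ? ?]; rewrite ?mul0r // wval_Dead mulr0.
Qed.

Lemma wt_ge0 a p q : List.In p states -> 0 <= wt a p q.
Proof.
move=> ps; have rs : (row_total p <= scale)%N.
  rewrite /scale leqW //; elim: states ps => //= p' s IHs.
  by rewrite big_cons => -[->|/IHs]; lia.
have [op|] := boolP (ordinary p).
  rewrite wt_ordinary // addr_ge0 ?divr_ge0 //.
  case: a => // ; case: q => //.
  by rewrite subr_ge0 ler_pdivrMr ?mul1r ?ler_nat ?ltr0n.
case: p {ps rs} => // b _; case: a => //; case: q => // b'.
  by move=> n /=; case: ifP => // _; case: n => [|[|n]]; exact: divr_ge0.
by rewrite /wt /mix_weight; case: b; case: b'; rewrite divr_ge0 ?ler01 ?ler0n.
Qed.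

Lemma size_states_gt : (13 < size states)%N.
Proof. by rewrite /states size_cat. Qed.

Lemma wa_M_chain : wa_M chain =
  [seq [seq [seq wt a p q | q <- states] | p <- states] | a <- letters].
Proof. by []. Qed.

Lemma wa_F_chain : wa_F chain = map is_fin states.
Proof. by []. Qed.

Lemma weight_chain a i j : (a < size letters)%N -> (i < size states)%N ->
  (j < size states)%N ->
  weight chain a i j =
  wt (nth Lstart letters a) (nth Dead states i) (nth Dead states j).
Proof.
move=> la li lj.
by rewrite /weight wa_M_chain (nth_map Lstart) // (nth_map Dead) // (nth_map Dead).
Qed.

Lemma In_nth (T : Type) (x0 : T) s i : (i < size s)%N -> List.In (nth x0 s i) s.
Proof. by elim: s i => //= y s IHs [|i] li; [left | right; exact: IHs]. Qed.

Lemma chain_wf : wf_WA chain.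
Proof.
rewrite /wf_WA wa_M_chain wa_F_chain !size_map; split=> //; split.
  move=> a la; rewrite (nth_map Lstart) // size_map; split=> // q lq.
  by rewrite (nth_map Dead) // size_map.
split=> // a i j.
have [la|la] := ltnP a (size letters); last first.
  rewrite /weight wa_M_chain [nth _ _ a]nth_default ?size_map //.
  by rewrite !nth_nil.
have [li|li] := ltnP i (size states); last first.
  rewrite /weight wa_M_chain (nth_map Lstart) // [nth _ _ i]nth_default ?size_map //.
  by rewrite nth_nil.
have [lj|lj] := ltnP j (size states); last first.
  rewrite /weight wa_M_chain (nth_map Lstart) // (nth_map Dead) //.
  by rewrite nth_default ?size_map.
by rewrite weight_chain // wt_ge0 //; exact: In_nth.
Qed.

Lemma final_chain i : (i < size states)%N ->
  final chain i = is_fin (nth Dead states i).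
Proof. by move=> li; rewrite /final wa_F_chain (nth_map Dead). Qed.

Lemma chain_LMC : is_LMC chain.
Proof.
split; first exact: chain_wf.
split=> i li; rewrite final_chain // => fi.
  rewrite -(row_sum fi) (big_nth Dead) big_mkord; apply: eq_bigr => j _.
  rewrite (big_nth Lstart) big_mkord; apply: eq_bigr => a _.
  exact: weight_chain.
move=> a j la lj; rewrite weight_chain //.
by case: (nth Dead states i) fi.
Qed.

Lemma nu_chain (R : realType) s (w : word chain) : (s < size states)%N ->
  nu R s w = ratr (wval (nth Dead states s)
                        [seq nth Lstart letters (nat_of_ord a) | a <- w]).
Proof.
move=> ls; rewrite /nu (insubT (fun i => (i < wa_n chain)%N) ls).
set i : 'I_(wa_n chain) := Sub s ls; rewrite -[s in RHS]/(nat_of_ord i).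
move: i => i {s ls}.
elim: w i => [|a w IHw] i.
  under eq_bigr => t _ do rewrite mxE.
  rewrite [wval _ _]/= -final_chain // ratr_nat.
  rewrite big_mkcond (bigD1 i) // eqxx big1 => [|t /negPf ti].
    by rewrite [LHS]addr0; case: (final chain i).
  by rewrite eq_sym ti if_same.
rewrite [map _ _]/= [wval _ _]/=.
have prodE t : prod_mx R (a :: w) i t = \sum_j wa_mx R a i j * prod_mx R w j t.
  by rewrite -[prod_mx R (a :: w)]/(wa_mx R a *m prod_mx R w) mxE.
rewrite (eq_bigr _ (fun t _ => prodE t)) exchange_big.
rewrite (big_nth Dead) big_mkord rmorph_sum.
apply: eq_bigr => j _; rewrite rmorphM -[LHS]mulr_sumr IHw mxE.
by rewrite -weight_chain.
Qed.

(** * Evolution of the products of variables along a word *)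

Lemma lval_sum l v : all (gtn r) l ->
  lval l v = (\sum_(i <- iota 0 r) count_mem i l * v i)%N.
Proof.
elim: l => [|k l IHl] /=; first by rewrite big1.
case/andP=> kr /IHl IH; rewrite /lval /= -/(lval l v) IH.
under [RHS]eq_bigr => i _ do rewrite mulnDl.
rewrite big_split /=; congr (_ + _)%N.
rewrite (bigD1_seq k) ?iota_uniq ?mem_iota //= eqxx mul1n big1 ?addn0 //.
by move=> i /negPf; rewrite eq_sym => ->.
Qed.

Lemma lval_mul l l' v : all (gtn r) l -> all (gtn r) l' ->
  (lval l v * lval l' v)%N =
  (\sum_(ij <- pairs) v ij.1 * v ij.2 * (count_mem ij.1 l * count_mem ij.2 l'))%N.
Proof.
move=> lr lr'; rewrite !lval_sum // big_allpairs /= big_distrlr /=.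
by do 2!apply: eq_bigr => ? _; rewrite mulnACA mulnC.
Qed.

Lemma gcostE b gs v : all (guard_ok r) gs ->
  gcost b gs v = (\sum_(ij <- pairs) v ij.1 * v ij.2 * gweight b gs ij.1 ij.2)%N.
Proof.
rewrite /gcost /gweight => okgs; under [RHS]eq_bigr => ij _ do rewrite big_distrr /=.
rewrite exchange_big /=; elim: gs okgs => [|g gs IH] /=; first by rewrite !big_nil.
case/andP=> /andP[g1 g2] /IH; rewrite !big_cons => ->; congr (_ + _)%N.
case: b {IH}; last first.
  rewrite lval_mul // big_distrr /=.
  by apply: eq_bigr => ij _; lia.
rewrite -!mulnn !lval_mul // -big_split /=.
by apply: eq_bigr => ij _; rewrite mulnDr.
Qed.

(** The weight of [w] when [Acc b] carries the mass [acc] and each [Vec b i j] the mass [v_i v_j].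
    While a run is read, the mass keeps this shape up to a scalar. *)
Definition total b (v : nat -> nat) (acc : nat) (w : seq letter) : rat :=
  acc%:R * wval (Acc b) w +
  \sum_(ij <- pairs) (v ij.1 * v ij.2)%:R * wval (Vec b ij.1 ij.2) w.

Definition end_cost b (v : nat -> nat) : nat :=
  (gcost b [:: pc_guard fin] v + ~~ b * (v 1 * v 1))%N.

Hypothesis r_gt2 : (2 < r)%N.

Lemma end_costE b v : end_cost b v =
  (\sum_(ij <- pairs) v ij.1 * v ij.2 * end_weight b ij.1 ij.2)%N.
Proof.
rewrite /end_cost gcostE /= ?pc_guard_ok //.
under [RHS]eq_bigr => ij _ do rewrite mulnDr.
rewrite big_split /=; congr (_ + _)%N; rewrite big_allpairs /=.
rewrite (bigD1_seq 1%N) ?iota_uniq ?mem_iota //=; last by lia.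
rewrite (bigD1_seq 1%N) ?iota_uniq ?mem_iota //=; last by lia.
rewrite big1 ?big1 ?addn0 ?mulnA; first by case: b => /=; lia.
  by move=> i /negPf i1; rewrite big1 // => j _; rewrite i1 andbF muln0.
by move=> i /negPf i1; rewrite i1 !andbF muln0.
Qed.

Lemma sum_vec_const (F : nat -> nat -> nat) v y c :
  \sum_(ij <- pairs) (v ij.1 * v ij.2)%:R * ((F ij.1 ij.2)%:R * y / c) =
  (\sum_(ij <- pairs) v ij.1 * v ij.2 * F ij.1 ij.2)%N%:R * y / c :> rat.
Proof.
rewrite natr_sum !mulr_suml; apply: eq_bigr => ij _.
by rewrite !natrM !mulrA.
Qed.

Lemma wval_sparse a p (f : rat) w : ordinary p ->
  \sum_(q <- states) (iw a p q)%:R * wval q w = f -> wval p (a :: w) = f / scale%:R.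
Proof. by move=> op <-; exact: wval_ordinary. Qed.

Lemma sum_mul0 (F : nat * nat -> rat) : \sum_(ij <- pairs) 0%:R * F ij = 0.
Proof. by rewrite big1 // => ij _; rewrite mul0r. Qed.

Lemma wval_Acc_cont b w : wval (Acc b) (Lcont :: w) = wval (Root b) w / scale%:R.
Proof.
apply: wval_sparse => //; rewrite big_states /= !sum_mul0.
by case: b; rewrite !mul0r mul1r !addr0 ?add0r.
Qed.

Lemma wval_Acc_stop b w : wval (Acc b) (Lstop :: w) = wval Fin w / scale%:R.
Proof.
by apply: wval_sparse => //; rewrite big_states /= !sum_mul0 !mul0r mul1r !addr0 ?add0r.
Qed.

Lemma wval_Acc_cmd b e w : wval (Acc b) (Lcmd e :: w) = wval (Acc b) w / scale%:R.
Proof.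
apply: wval_sparse => //; rewrite big_states /= !sum_mul0.
by case: b; rewrite !mul0r mul1r !addr0 ?add0r.
Qed.

Lemma wval_Vec_cont b i j w :
  wval (Vec b i j) (Lcont :: w) = (end_weight b i j)%:R * wval (Root b) w / scale%:R.
Proof.
apply: wval_sparse => //; rewrite big_states /= !sum_mul0.
by case: b; rewrite !mul0n mul1n !mul0r !addr0 ?add0r.
Qed.

Lemma wval_Vec_stop b i j w :
  wval (Vec b i j) (Lstop :: w) = (end_weight b i j)%:R * wval Fin w / scale%:R.
Proof.
by apply: wval_sparse => //; rewrite big_states /= !sum_mul0 !mul0r !addr0 ?add0r.
Qed.

Lemma wval_Vec_cmd b i j e w :
  wval (Vec b i j) (Lcmd e :: w) =
  ((gweight b (guards e) i j)%:R * wval (Acc b) w +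
   \sum_(kl <- pairs) (count_mem i (mupd e kl.1) * count_mem j (mupd e kl.2))%:R *
      wval (Vec b kl.1 kl.2) w) / scale%:R.
Proof.
apply: wval_sparse => //; rewrite big_states /=.
case: b; rewrite !mul0n mul1n ?sum_mul0 !mul0r !addr0 ?add0r.
  by congr (_ + _); apply: eq_bigr => kl _; rewrite mul1n.
by congr (_ + _); apply: eq_bigr => kl _; rewrite mul1n.
Qed.

Lemma total_cont b v acc w :
  total b v acc (Lcont :: w) =
  (acc + end_cost b v)%:R * wval (Root b) w / scale%:R.
Proof.
rewrite /total wval_Acc_cont; under eq_bigr => ij _ do rewrite wval_Vec_cont.
by rewrite sum_vec_const -end_costE natrD mulrDl mulrDl mulrA.
Qed.

Lemma total_stop b v acc w :
  total b v acc (Lstop :: w) = (acc + end_cost b v)%:R * wval Fin w / scale%:R.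
Proof.
rewrite /total wval_Acc_stop; under eq_bigr => ij _ do rewrite wval_Vec_stop.
by rewrite sum_vec_const -end_costE natrD mulrDl mulrDl mulrA.
Qed.

(** The product of two updated variables is bilinear in the old ones, so the [Vec] states pass to
    the products for [mstep e v], while [Acc b] collects the quadratic form of the tests. *)
Lemma total_cmd b v acc e w : edge_ok r e ->
  total b v acc (Lcmd e :: w) =
  total b (mstep e v) (acc + gcost b (guards e) v) w / scale%:R.
Proof.
move=> oke; rewrite /total wval_Acc_cmd.
under eq_bigr => ij _ do rewrite wval_Vec_cmd mulrDl mulrDr.
rewrite big_split /= sum_vec_const -gcostE ?guards_ok // addrA mulrA -mulrDl.
rewrite -mulrDl -natrD mulrDl; congr (_ + _).
rewrite mulr_suml; under eq_bigr => ij _ do rewrite mulr_suml mulr_sumr.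
rewrite exchange_big /=; apply: eq_big_seq => kl klP.
have /andP[k_r l_r] : (kl.1 < r)%N && (kl.2 < r)%N.
  by case/allpairsP: klP => -[k l] /= [+ + ->]; rewrite !mem_iota !add0n => /= -> ->.
rewrite /mstep lval_mul ?mupd_ok // natr_sum !mulr_suml.
by apply: eq_bigr => ij _; rewrite !natrM !mulrA.
Qed.

Lemma total0 b v acc a w :
  match a with Lstart | Linit | Lmix => True | _ => False end ->
  total b v acc (a :: w) = 0.
Proof.
move=> an; rewrite /total (@wval_sparse _ _ 0); first last.
- by rewrite big_states; case: a an => //= _; rewrite !sum_mul0 !mul0r !addr0.
- by [].
rewrite mul0r mulr0 add0r big1 // => ij _; rewrite (@wval_sparse _ _ 0).
- by rewrite mul0r mulr0.
- by [].
- by rewrite big_states; case: a an => //= _; rewrite !sum_mul0 !mul0r !addr0.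
Qed.

Definition v0 : nat -> nat := cfg 0 (input_store x).

Lemma wval_Ini b n w : wval (Ini b n) (Linit :: w) =
  (\sum_(ij <- pairs) (init_weight n ij.1 ij.2)%:R * wval (Vec b ij.1 ij.2) w) /
    scale%:R.
Proof.
apply: wval_sparse => //; rewrite big_states /= wval_Dead mulr0.
case: b; rewrite !mul0r !sum_mul0 !addr0 ?add0r.
  by apply: eq_bigr => ij _; rewrite mul1n.
by apply: eq_bigr => ij _; rewrite mul1n.
Qed.

Lemma wval_Ini0 b n a w : (if a is Linit then False else True) ->
  wval (Ini b n) (a :: w) = 0.
Proof.
move=> an; rewrite (@wval_sparse _ _ 0) ?mul0r // big1 // => q _.
by case: a an => //= *; rewrite mul0r.
Qed.

Lemma wval_Root_start b w : wval (Root b) (Lstart :: w) =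
  start_weight 0 * wval (Ini b 0) w + start_weight 1 * wval (Ini b 1) w +
  start_weight 2 * wval (Ini b 2) w.
Proof.
rewrite [LHS]/= big_states !big1 => [|ij _|ij _]; [|exact: mul0r|exact: mul0r].
by case: b; rewrite [LHS]/= !mul0r !addr0 !add0r.
Qed.

Lemma v0_mul i j : (v0 i * v0 j)%N =
  (x * x * init_weight 0 i j + x * init_weight 1 i j + init_weight 2 i j)%N.
Proof.
by case: i => [|[|[|i]]]; case: j => [|[|[|j]]]; rewrite /v0 /input_store /=; lia.
Qed.

Lemma wval_start b w : wval (Root b) [:: Lstart, Linit & w] =
  total b v0 0 w / (denom%:R * scale%:R).
Proof.
rewrite wval_Root_start !wval_Ini /total mul0r add0r /start_weight.
set S := fun n =>
  \sum_(ij <- pairs) (init_weight n ij.1 ij.2)%:R * wval (Vec b ij.1 ij.2) w.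
rewrite [X in _ = X / _](_ : _ = (x * x)%:R * S 0%N + x%:R * S 1%N + S 2).
  by rewrite -/(S 0%N) -/(S 1%N) -/(S 2); field; rewrite denom_neq0 scale_neq0.
rewrite /S !mulr_sumr -!big_split /=; apply: eq_bigr => ij _.
by rewrite v0_mul !natrD !natrM; ring.
Qed.

Lemma wval_Root0 b a w : (if a is Lstart then False else True) ->
  wval (Root b) (a :: w) = 0.
Proof. by move=> an /=; rewrite big1 // => q _; case: a an => //= *; rewrite mul0r. Qed.

Lemma wval_Root_start0 b a w : (if a is Linit then False else True) ->
  wval (Root b) [:: Lstart, a & w] = 0.
Proof. by move=> an; rewrite wval_Root_start !wval_Ini0 // !mulr0 !addr0. Qed.

Lemma wval_Mix b w : wval (Mix b) (Lmix :: w) =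
  mix_weight b false * wval (Root false) w + mix_weight b true * wval (Root true) w.
Proof.
rewrite [LHS]/= big_states !big1 => [|ij _|ij _]; [|exact: mul0r|exact: mul0r].
by rewrite !mul0r !addr0.
Qed.

Lemma wval_Mix0 b a w : (if a is Lmix then False else True) ->
  wval (Mix b) (a :: w) = 0.
Proof. by move=> an /=; rewrite big1 // => q _; case: a an => //= *; rewrite mul0r. Qed.

(** * Comparison of the two roots *)

Hypothesis E_ok : forall e, List.In e E -> edge_ok r e.

Definition letter_ok (a : letter) : Prop := if a is Lcmd e then List.In e E else True.

Definition step_path := epath (fun e => List.In e E).

Lemma sumr_ge0_In (T : Type) (s : seq T) (F : T -> rat) :
  (forall q, List.In q s -> 0 <= F q) -> 0 <= \sum_(q <- s) F q.
Proof.
elim: s => [|q s IHs] F_ge0; first by rewrite big_nil.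
rewrite big_cons addr_ge0 ?F_ge0 //=; first by left.
by apply: IHs => p ps; apply: F_ge0; right.
Qed.

Lemma wval_ge0 p w : List.In p states -> 0 <= wval p w.
Proof.
elim: w p => [|a w IHw] p ps; first exact: ler0n.
by apply: sumr_ge0_In => q qs; rewrite mulr_ge0 ?wt_ge0 ?IHw.
Qed.

Lemma scale_gt0 : 0 < scale%:R :> rat.
Proof. by rewrite ltr0n. Qed.

Lemma denom_gt0 : 0 < denom%:R :> rat.
Proof. by rewrite ltr0n /denom addn1. Qed.

Lemma total_nil b v acc : total b v acc [::] = 0.
Proof. by rewrite /total big1 ?mulr0 ?addr0 // => ij _; rewrite mulr0. Qed.

Lemma mstep1 e v : mstep e v 1%N = v 1%N.
Proof. by case: e => -[p [i f|f g]] q; rewrite /mstep /lval /= addn0. Qed.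

(* Either some test has already failed, or the run is so far correct. *)
Definition run_inv (v : nat -> nat) (acc acc' : nat) : Prop :=
  v 1%N = 1%N /\ ((acc < acc')%N \/ acc = acc' /\
    exists p s, v = cfg p s /\ step_path 0 (input_store x) p s).

Lemma epath_rcons (D : edge -> Prop) p s q t a p' t' :
  epath D p s q t -> D (q, a, p') -> astep a t t' -> epath D p s p' t'.
Proof. by move=> run d st; apply: epath_cat run (epath1 d st). Qed.

Lemma run_inv_cmd v acc acc' e : List.In e E -> run_inv v acc acc' ->
  run_inv (mstep e v) (acc + gcost false (guards e) v)
                      (acc' + gcost true (guards e) v).
Proof.
move=> eE [v1 inv]; split; first by rewrite mstep1.
case: inv => [lt|[-> [p [s [-> run]]]]].
  by left; have := gcost_leq (guards e) v; lia.
have [ok|/gcost_fail lt] := boolP (passes (guards e) (cfg p s)); last first.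
  by left; rewrite ltn_add2l.
right; rewrite gcost_pass //; split=> //.
case: e eE ok => -[q a] q' eE /passes_guards[pq [t st]]; subst q.
by exists q', t; rewrite (mstep_cfg _ _ _ st); split=> //; exact: epath_rcons run eE st.
Qed.

Lemma end_cost_true v : end_cost true v = gcost true [:: pc_guard fin] v.
Proof. exact: addn0. Qed.

Lemma end_cost_false v : v 1%N = 1%N ->
  end_cost false v = (gcost false [:: pc_guard fin] v).+1.
Proof. by move=> v1; rewrite /end_cost v1 addn1. Qed.

(** The extra one of [end_cost false] is absorbed by a gap of at least one: either an earlier test
    has failed, or the run is correct and, as [fin] is unreachable, the final test of the program
    counter fails. *)
Lemma run_inv_end v acc acc' :
  (forall s, ~ step_path 0 (input_store x) fin s) -> run_inv v acc acc' ->
  (acc + end_cost false v <= acc' + end_cost true v)%N.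
Proof.
move=> nohalt [v1 inv]; rewrite end_cost_true end_cost_false //.
case: inv => [lt|[-> [p [s [-> run]]]]].
  by have := gcost_leq [:: pc_guard fin] v; lia.
rewrite leq_add2l; apply: gcost_fail; rewrite passes_pc.
by apply/eqP => pf; subst p; exact: nohalt run.
Qed.

Lemma Root_In b : List.In (Root b) states.
Proof. by case: b; [right; left|left]. Qed.

Lemma Fin_In : List.In Fin states.
Proof. by do 10!right; left. Qed.

(** At [Lcont] the weight is, up to scaling, the cost sum of the run times the root weight of the
    rest. Both factors are ordered, so the inequality survives concatenation. *)
Lemma diverging_bound w :
  (forall s, ~ step_path 0 (input_store x) fin s) -> List.Forall letter_ok w ->
  wval (Root false) w <= wval (Root true) w.
Proof.
move=> nohalt okw.
(* The three claims are the positions inside a block: before [Lstart], between [Lstart] and [Linit],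
   and during a run. Together they allow an induction letter by letter. *)
suff [] : [/\ wval (Root false) w <= wval (Root true) w,
    wval (Root false) (Lstart :: w) <= wval (Root true) (Lstart :: w) &
    forall v acc acc', run_inv v acc acc' ->
      total false v acc w <= total true v acc' w].
  by [].
elim: okw => {w} [|a w oka okw [IHr IHs IHt]].
  split=> // [|v acc acc' _]; last by rewrite !total_nil.
  by rewrite !wval_Root_start /= !mulr0.
split.
- by case: a {oka} => // [||||e]; rewrite !wval_Root0.
- have [->|na] : a = Linit \/ (if a is Linit then False else True);
    [by case: (a); auto| |by rewrite !wval_Root_start0].
  rewrite !wval_start.
  rewrite ler_wpM2r ?invr_ge0 ?mulr_ge0 ?ler0n // IHt //.
  split=> //; right; split=> //; exists 0%N, (input_store x); split=> //.
  exact: epath_nil.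
move=> v acc acc' inv; case: a oka => [_|_|_|_|_|e eE].
- by rewrite !total0.
- by rewrite !total0.
- rewrite !total_cont ler_wpM2r ?invr_ge0 ?ler0n //.
  apply: ler_pM => //; first by apply: wval_ge0; exact: Root_In.
  by rewrite ler_nat run_inv_end.
- rewrite !total_stop ler_wpM2r ?invr_ge0 ?ler0n //.
  apply: ler_wpM2r; first by apply: wval_ge0; exact: Fin_In.
  by rewrite ler_nat run_inv_end.
- by rewrite !total0.
- rewrite !total_cmd ?E_ok // ler_wpM2r ?invr_ge0 ?ler0n //.
  by apply: IHt; exact: run_inv_cmd.
Qed.

(** All tests pass along a path, so the two costs agree and one word [u] and one number [G] serve
    both values of [b]. *)
Lemma step_path_word p s q t : step_path p s q t ->
  exists u G, List.Forall letter_ok u /\ forall b acc w,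
    total b (cfg p s) acc (u ++ w) =
    total b (cfg q t) (acc + G) w / scale%:R ^+ size u.
Proof.
elim=> {p s q t} [p s|p a q s t p' s' pq st _ [u [G [oku IH]]]].
  exists [::], 0%N; split=> [|b acc w]; first exact: List.Forall_nil.
  by rewrite addn0 expr0 divr1.
exists (Lcmd (p, a, q) :: u), (gcost false (guards (p, a, q)) (cfg p s) + G)%N.
split=> [|b acc w]; first exact: List.Forall_cons.
rewrite /= total_cmd ?E_ok // (mstep_cfg _ _ _ st) IH addnA exprSr invfM mulrA.
suff -> : gcost b (guards (p, a, q)) (cfg p s) =
          gcost false (guards (p, a, q)) (cfg p s) by [].
by case: b => //; rewrite gcost_pass //; apply/passes_guards; split=> //; exists t.
Qed.

(** Bernoulli's inequality [(1 + 1/F)^m >= 1 + m/F], cleared of denominators, shows that the powers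
    of [(F + 1)/F] are unbounded. *)
Lemma exp_succ_gap F K : exists m, (K * F ^ m.+1 < F.+1 ^ m.+1)%N.
Proof.
have bern m : (F ^ m * (F + m) <= F * F.+1 ^ m)%N.
  elim: m => [|m IHm]; first by rewrite !expn0; lia.
  have -> : (F ^ m.+1 * (F + m.+1) = F ^ m * (F * (F + m.+1)))%N by rewrite expnS; lia.
  apply: (@leq_trans (F ^ m * ((F + m) * F.+1))).
    by rewrite leq_mul2l; apply/orP; right; nia.
  by rewrite mulnA expnSr mulnA leq_mul2r IHm orbT.
exists (K * F)%N; have [->|F0] := posnP F; first by rewrite exp0n // muln0 exp1n.
rewrite -(ltn_pmul2l F0); apply: leq_trans (bern _).
have : (0 < F ^ (K * F).+1)%N by rewrite expn_gt0 F0.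
by set X := (F ^ _)%N; nia.
Qed.

(** One halting run has cost sums [F + 1] and [F]; repeating it [m.+1] times raises their ratio to
    the power [m.+1]. *)
Lemma halting_unbounded K t : step_path 0 (input_store x) fin t ->
  exists2 w, List.Forall letter_ok w &
    K%:R * wval (Root true) w < wval (Root false) w.
Proof.
move=> /step_path_word[u [G [oku uE]]].
pose F := (G + end_cost true (cfg fin t))%N.
have endF b : (0 + G + end_cost b (cfg fin t) = F + ~~ b)%N.
  rewrite /F add0n; case: b; first by rewrite addn0.
  by rewrite end_cost_true end_cost_false // addn1 addnS gcost_pass ?passes_pc.
(* The scaling of one block, common to both roots: a factor for each command, one for the closing
   letter, and those of [Lstart] and [Linit]. *)
pose c : rat := (scale%:R ^+ size u)^-1 / scale%:R / (denom%:R * scale%:R).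
have c_gt0 : 0 < c.
  by rewrite /c !(divr_gt0, mulr_gt0, invr_gt0, exprn_gt0) ?scale_gt0 ?denom_gt0.
pose block a w := [:: Lstart, Linit & u ++ a :: w].
have cont b w : wval (Root b) (block Lcont w) = c * (F + ~~ b)%:R * wval (Root b) w.
  rewrite /block wval_start uE total_cont endF /c; field.
  by rewrite expf_neq0 ?scale_neq0 ?denom_neq0.
have stop b : wval (Root b) (block Lstop [::]) = c * (F + ~~ b)%:R.
  rewrite /block wval_start uE total_stop endF /c /=; field.
  by rewrite expf_neq0 ?scale_neq0 ?denom_neq0.
have ok_block a w : letter_ok a -> List.Forall letter_ok w ->
    List.Forall letter_ok (block a w).
  move=> oka okw; do 2!apply: List.Forall_cons => //.
  by elim: oku => [|a' u' oka' _ IH] /=; exact: List.Forall_cons.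
have [m lt_m] := exp_succ_gap F K.
exists (iter m (block Lcont) (block Lstop [::])).
  by elim: m {lt_m} => [|m IHm] /=; apply: ok_block.
have valE b : wval (Root b) (iter m (block Lcont) (block Lstop [::])) =
    c ^+ m.+1 * ((F + ~~ b) ^ m.+1)%:R.
  elim: m {lt_m} => [|m IHm]; first by rewrite expr1 expn1 stop.
  by rewrite iterS cont IHm mulrACA -natrM -exprS -expnS.
rewrite !valE /= mulrCA ltr_pM2l ?exprn_gt0 // addn0 addn1 -natrM ltr_nat.
exact: lt_m.
Qed.

End Chain.

(** * Distances *)

Section TotalVariation.
Variables (R : realType) (A : WA).
Local Open Scope ring_scope.

Hypothesis nu_ge0 : forall s (w : word A), 0 <= nu R s w.

Lemma nuE_ge0 s (E : set (word A)) : (0 <= nuE R s E)%E.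
Proof. by apply: esum_ge0 => w _; rewrite lee_fin. Qed.

Lemma le_nuE s s' (K : R) (E : set (word A)) : 0 <= K ->
  (forall w : word A, nu R s w <= K * nu R s' w) ->
  (nuE R s E <= K%:E * nuE R s' E)%E.
Proof.
move=> K0 le_nu; apply: ge_ereal_sup => _ [X [finX XE] <-].
apply: (@le_trans _ _ (K%:E * \sum_(w \in X) (nu R s' w)%:E)%E); last first.
  by rewrite lee_wpmul2l ?lee_fin // esum_ge //; exists X.
rewrite ge0_mule_fsumr => [|w]; last by rewrite lee_fin.
by apply: lee_fsum => // w _; rewrite -EFinM lee_fin.
Qed.

Lemma tvx_le s s' (K : R) : 0 <= K ->
  (forall w : word A, nu R s w <= K * nu R s' w) -> (tvx R A s s' <= K%:E)%E.
Proof.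
move=> K0 le_nu; apply: ge_ereal_sup => _ [E _ <-].
have := le_nuE E K0 le_nu; have := nuE_ge0 s E; have := nuE_ge0 s' E.
rewrite /eratio; move: (nuE R s E) (nuE R s' E) => X Y.
case: eqP => [-> _ X0|_ Y0 X0 XY].
  by rewrite mule0 => X0'; rewrite eq_le X0 X0' /= lee_fin.
rewrite lee_fin; case: Y Y0 XY => [y||] //=.
  rewrite lee_fin => y0; case: X X0 => [z||] // z0.
  rewrite -EFinM lee_fin => zy; have [->|yn0] := eqVneq y 0.
    by rewrite invr0 mulr0.
  by rewrite ler_pdivrMr // lt0r yn0.
(* If the denominator is [+oo], its [fine] is zero, and the quotient is zero by the convention on
   inverses. *)
by rewrite invr0 mulr0.
Qed.

Lemma tvx_ge s s' (c : R) (w : word A) : 0 < nu R s' w ->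
  c * nu R s' w <= nu R s w -> (c%:E <= tvx R A s s')%E.
Proof.
move=> w0 le_c; apply: le_ereal_sup_tmp.
exists (eratio (nuE R s [set w]%classic) (nuE R s' [set w]%classic)).
  by exists [set w]%classic.
rewrite /nuE !esum_set1 ?lee_fin // /eratio eqe gt_eqF //=.
by rewrite lee_fin ler_pdivlMr.
Qed.

Lemma tvx_ge0 s s' : (0 <= tvx R A s s')%E.
Proof.
apply: le_ereal_sup_tmp; exists (eratio (@nuE R A s set0) (@nuE R A s' set0)).
  by exists set0.
by rewrite /nuE !esum_set0 /eratio !eqxx.
Qed.

End TotalVariation.

(** * Big-O and distances in the chain *)

Section ChainDistances.
Variables (E : seq edge) (fin r x : nat) (R : realType).
Hypothesis r_gt2 : 2 < r.
Hypothesis E_ok : forall e, List.In e E -> edge_ok r e.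
Local Notation A := (chain E fin r x).
Local Notation halts :=
  (exists t, epath (fun e => List.In e E) 0 (input_store x) fin t).
Local Open Scope ring_scope.

Lemma In_ex_nth (T : Type) (y0 y : T) s : List.In y s ->
  exists2 i, (i < size s)%N & nth y0 s i = y.
Proof.
elim: s => //= z s IHs [->|/IHs[i li <-]]; first by exists 0%N.
by exists i.+1.
Qed.

Lemma In_letters a : List.In a (letters E) <-> letter_ok E a.
Proof.
rewrite In_cat; split.
  case; first by do 5!case=> [<-//|].
  by elim: E => //= e E' IH [<-|]; [left | case: (a) IH => // e' IH /IH; right].
case: a => [||||| e] /=; try by left; intuition.
move=> eE; right; elim: E eE => //= e' E' IH [->|/IH]; [by left | by right].
Qed.

Lemma word_letters_ok (w : word A) :
  List.Forall (letter_ok E) [seq nth Lstart (letters E) (nat_of_ord a) | a <- w].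
Proof.
elim: w => [|a w IHw]; first exact: List.Forall_nil.
by apply: List.Forall_cons => //; apply/In_letters; apply: In_nth.
Qed.

Lemma letters_word lw : List.Forall (letter_ok E) lw ->
  exists w : word A, [seq nth Lstart (letters E) (nat_of_ord a) | a <- w] = lw.
Proof.
elim=> [|a {}lw oka _ [w <-]]; first by exists [::].
have /(In_ex_nth Lstart)[i li <-] : List.In a (letters E) by apply/In_letters.
by exists (Ordinal (li : i < wa_k A)%N :: w).
Qed.

Local Notation wv p w := (wval E fin r x p w).

(** Indices of the roots and mixtures in [states]; they are the same for all [r]. *)
Definition root0 : nat := 0.
Definition root1 : nat := 1.
Definition mix0 : nat := 8.
Definition mix1 : nat := 9.

Lemma nu_chain_ge0 s (w : word A) : 0 <= nu R s w.
Proof.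
have [ls|ls] := ltnP s (size (states r)); last first.
  by rewrite /nu insubF //; apply/negbTE; rewrite -leqNgt.
by rewrite nu_chain // ler0q; apply: wval_ge0 => //; exact: In_nth.
Qed.

Lemma nuE_chain s p (w : word A) : (s < 14)%N -> nth Dead (states r) s = p ->
  nu R s w = ratr (wv p [seq nth Lstart (letters E) (nat_of_ord a) | a <- w]).
Proof.
by move=> ls <-; rewrite nu_chain //; apply: leq_trans ls (size_states_gt r).
Qed.

Lemma ratrM (a b : rat) : ratr (a * b) = ratr a * ratr b :> R.
Proof. exact: rmorphM. Qed.

Lemma nu_le s s' p p' (K : rat) : (s < 14)%N -> nth Dead (states r) s = p ->
  (s' < 14)%N -> nth Dead (states r) s' = p' ->
  (forall lw, List.Forall (letter_ok E) lw -> wv p lw <= K * wv p' lw) ->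
  forall w : word A, nu R s w <= ratr K * nu R s' w.
Proof.
move=> ls sp ls' sp' le_v w.
rewrite (nuE_chain _ ls sp) (nuE_chain _ ls' sp') -ratrM ler_rat.
by apply: le_v; exact: word_letters_ok.
Qed.

Lemma diverging_bigO : ~ halts -> big_O R A root0 root1.
Proof.
move=> nh; exists (ratr 1); split; first by rewrite ltr0q.
apply: nu_le => // lw oklw; rewrite mul1r.
by apply: diverging_bound => // s run; apply: nh; exists s.
Qed.

Lemma halting_not_bigO : halts -> ~ big_O R A root0 root1.
Proof.
move=> [t run] [C [C_gt0 leC]].
have [lw oklw] := halting_unbounded r_gt2 E_ok (Num.bound C) run.
have [w <-] := letters_word oklw; rewrite -(ltr_rat R) ratrM ratr_nat.
rewrite -(@nuE_chain root1) // -(@nuE_chain root0) // ltNge => /negP[].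
apply: le_trans (leC w) _; apply: ler_wpM2r; first exact: nu_chain_ge0.
by apply/ltW/archi_boundP/ltW.
Qed.

Lemma wval_Root_ge0 b lw : 0 <= wv (Root b) lw.
Proof. by apply: wval_ge0; exact: Root_In. Qed.

Lemma mix_cases (Q : rat -> rat -> Prop) lw : Q 0 0 ->
  (forall lw', lw = Lmix :: lw' ->
     let u := wv (Root false) lw' in let v := wv (Root true) lw' in
     Q (1 / 2 * u + 1 / 2 * v) (1 / 32 * u + 31 / 32 * v)) ->
  Q (wv (Mix false) lw) (wv (Mix true) lw).
Proof.
move=> Q0 QS; case: lw QS => // a lw QS.
have [aE|an] : a = Lmix \/ (if a is Lmix then False else True).
- by case: (a); auto.
- by subst a; rewrite !wval_Mix; exact: QS.
- by rewrite !wval_Mix0.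
Qed.

Lemma mix_bounded lw : wv (Mix false) lw <= 16 * wv (Mix true) lw.
Proof.
apply: (mix_cases (Q := fun u v => u <= 16 * v)) => [|lw' _ u v]; first by lra.
by have := wval_Root_ge0 false lw'; have := wval_Root_ge0 true lw';
  rewrite -/u -/v; lra.
Qed.

Lemma mix_bounded_rev lw : wv (Mix true) lw <= 2 * wv (Mix false) lw.
Proof.
apply: (mix_cases (Q := fun u v => v <= 2 * u)) => [|lw' _ u v]; first by lra.
by have := wval_Root_ge0 false lw'; have := wval_Root_ge0 true lw';
  rewrite -/u -/v; lra.
Qed.

Lemma mix_diverging lw : ~ halts -> List.Forall (letter_ok E) lw ->
  wv (Mix false) lw <= 2 * wv (Mix true) lw.
Proof.
move=> nh; apply: (mix_cases (Q := fun u v => _ -> u <= 2 * v)) => [_|]; first by lra.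
move=> lw' -> u v okl; have oklw' : List.Forall (letter_ok E) lw' by inversion okl.
have := wval_Root_ge0 false lw'; have := wval_Root_ge0 true lw'.
have : u <= v by apply: diverging_bound => // s run; apply: nh; exists s.
by rewrite -/u -/v; lra.
Qed.

Lemma mix_halting : halts -> exists2 lw, List.Forall (letter_ok E) lw &
  0 < wv (Mix true) lw /\ 8 * wv (Mix true) lw <= wv (Mix false) lw.
Proof.
(* For root weights [u] and [v], the inequality [8 (u + 31 v) / 32 <= (u + v) / 2] amounts to
   [29 v <= u]. *)
move=> [t /(halting_unbounded r_gt2 E_ok 29)[lw oklw lt29]].
exists (Lmix :: lw); first exact: List.Forall_cons.
have := wval_Root_ge0 true lw; rewrite !wval_Mix /mix_weight.
by move: lt29; split; lra.
Qed.

Lemma chain_states_ok s s' : (s < 14)%N -> (s' < 14)%N -> states_ok A s s'.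
Proof.
by move=> ls ls'; split; apply: leq_trans (size_states_gt r).
Qed.

Section Distance.
Variable d : WA -> nat -> nat -> \bar R.
Hypothesis dE : d = @tvx R \/ d = @tvx_sym R.

(** The bound [2 <= K] covers the reversed ratio, which enters [tvx_sym]. *)
Lemma dist_le (K : rat) : 2 <= K ->
  (forall lw, List.Forall (letter_ok E) lw ->
     wv (Mix false) lw <= K * wv (Mix true) lw) ->
  (d A mix0 mix1 <= (ratr K)%:E)%E.
Proof.
move=> K2 le_v; have K0 : 0 <= ratr K :> R by rewrite ler0q; lra.
have le1 : (tvx R A mix0 mix1 <= (ratr K)%:E)%E.
  by apply: tvx_le => //; [exact: nu_chain_ge0 | exact: nu_le le_v].
case: dE => -> //; rewrite /tvx_sym ge_max le1 /=.
apply: tvx_le => //; first exact: nu_chain_ge0.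
apply: nu_le => // lw _; apply: le_trans (mix_bounded_rev lw) _.
apply: ler_wpM2r => //; apply: wval_ge0; by do 8!right; left.
Qed.

Lemma dist_finite : (d A mix0 mix1 <= 16%:E)%E.
Proof.
rewrite -[16](ratr_nat R); apply: dist_le => // lw _; exact: mix_bounded.
Qed.

Lemma dist_diverging : ~ halts -> (d A mix0 mix1 <= 2%:E)%E.
Proof.
move=> nh; rewrite -[2](ratr_nat R); apply: dist_le => // lw.
exact: mix_diverging.
Qed.

Lemma dist_halting : halts -> (8%:E <= d A mix0 mix1)%E.
Proof.
move=> /mix_halting[lw /letters_word[w <-]].
rewrite -(ltr0q R) -(ler_rat R) ratrM ratr_nat.
rewrite -(@nuE_chain mix1) // -(@nuE_chain mix0) // => -[w0 le8].
have le_t : (8%:E <= tvx R A mix0 mix1)%E.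
  by apply: tvx_ge le8 => //; exact: nu_chain_ge0.
by case: dE => -> //; rewrite le_max le_t.
Qed.

Lemma dist_ge0 : (0 <= d A mix0 mix1)%E.
Proof.
have t0 : (0 <= tvx R A mix0 mix1)%E by apply: tvx_ge0; exact: nu_chain_ge0.
by case: dE => -> //; rewrite le_max t0.
Qed.

End Distance.
End ChainDistances.

(** * The diagonal argument *)

(** The identity, as a recursion with bound [x.+1] that returns its last counter. *)
Definition cId : code := cComp (cRec cZero (cComp cFst cSnd)) (cPair cZero cSucc).

Lemma ev_id x : eval cId x x.
Proof.
apply: evComp; first by apply: evPair; constructor.
have [a ea] : exists a, eval (cRec cZero (cComp cFst cSnd)) (cpair 0 x) a.
  elim: x => [|x [a ea]]; first by exists 0; do 2 constructor.
  by exists x; apply: evRecS ea _; apply: evComp; constructor.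
by apply: evRecS ea _; apply: evComp; constructor.
Qed.

Definition cConst (n : nat) : code := iter n (cComp cSucc) cZero.

Lemma ev_const n x : eval (cConst n) x n.
Proof. by elim: n => [|n IHn]; [constructor | apply: evComp IHn _; constructor]. Qed.

Definition cAdd (f g : code) : code :=
  cComp (cRec cId (cComp cSucc (cComp cSnd cSnd))) (cPair f g).

Lemma ev_add f g x a b : eval f x a -> eval g x b -> eval (cAdd f g) x (a + b).
Proof.
move=> fa gb; apply: evComp; first exact: evPair fa gb.
elim: b {gb} => [|b IHb]; first by rewrite addn0; apply/evRec0/ev_id.
by rewrite addnS; apply: evRecS IHb _; do !apply: evComp; constructor.
Qed.

Definition cMul (f g : code) : code :=
  cComp (cRec cZero (cAdd (cComp cSnd cSnd) cFst)) (cPair f g).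

Lemma ev_mul f g x a b : eval f x a -> eval g x b -> eval (cMul f g) x (a * b).
Proof.
move=> fa gb; apply: evComp; first exact: evPair fa gb.
elim: b {gb} => [|b IHb]; first by rewrite muln0; do 2 constructor.
rewrite mulnS addnC; apply: evRecS IHb _; apply: ev_add; last by constructor.
by apply: evComp; constructor.
Qed.

Definition cPred (f : code) : code :=
  cComp (cRec cZero (cComp cFst cSnd)) (cPair cZero f).

Lemma ev_pred f x a : eval f x a -> eval (cPred f) x a.-1.
Proof.
move=> fa; apply: evComp; first by apply: evPair fa; constructor.
elim: a {fa} => [|a IHa]; first by do 2 constructor.
by apply: evRecS IHa _; apply: evComp; constructor.
Qed.

Definition cSub (f g : code) : code :=
  cComp (cRec cId (cPred (cComp cSnd cSnd))) (cPair f g).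

Lemma ev_sub f g x a b : eval f x a -> eval g x b -> eval (cSub f g) x (a - b).
Proof.
move=> fa gb; apply: evComp; first exact: evPair fa gb.
elim: b {gb} => [|b IHb]; first by rewrite subn0; apply/evRec0/ev_id.
by rewrite subnS; apply: evRecS IHb _; apply: ev_pred; apply: evComp; constructor.
Qed.

Definition cCons (f g : code) : code := cComp cSucc (cPair f g).

Lemma ev_cons f g x a b : eval f x a -> eval g x b ->
  eval (cCons f g) x (cpair a b).+1.
Proof. by move=> fa gb; apply: evComp; [exact: evPair fa gb | constructor]. Qed.

Lemma ev_comp_snd f a b c : eval f b c -> eval (cComp f cSnd) (cpair a b) c.
Proof. by move=> fb; apply: evComp fb; constructor. Qed.

Lemma enc_rat_coprime (n d : nat) : coprime n d -> 0 < d ->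
  enc_rat (n%:R / d%:R)%R = cpair n.*2 d.*2.
Proof.
move=> nd d0; have nd' : coprime `|Posz n| `|Posz d| by [].
rewrite /enc_rat !pmulrn coprimeq_num // coprimeq_den //.
case: d d0 {nd nd'} => // d _.
by rewrite gtr0_sg // mul1r.
Qed.

(** * Dependence of the encoded chain on its input *)

Section Template.
Variables (E : seq edge) (fin r : nat).

Lemma map_states (T : Type) (F : state -> T) : map F (states r) =
  [:: F (Root false); F (Root true); F (Ini false 0); F (Ini false 1);
      F (Ini false 2); F (Ini true 0); F (Ini true 1); F (Ini true 2);
      F (Mix false); F (Mix true); F Fin; F Dead; F (Acc false); F (Acc true)] ++
  [seq F (Vec false ij.1 ij.2) | ij <- pairs r] ++
  [seq F (Vec true ij.1 ij.2) | ij <- pairs r].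
Proof. by rewrite /states !map_cat -!map_comp. Qed.

Definition is_root (p : state) : bool := if p is Root _ then true else false.

Definition is_start (a : letter) : bool := if a is Lstart then true else false.

Lemma wt_irrelevant x a p q : ~~ (is_start a && is_root p) ->
  wt E fin r x a p q = wt E fin r 0 a p q.
Proof. by case: p => // b; case: a. Qed.

Lemma eq_map_In (T T' : Type) (f g : T -> T') s :
  (forall y, List.In y s -> f y = g y) -> map f s = map g s.
Proof.
elim: s => //= y s IHs fg; rewrite fg; last by left.
by rewrite IHs // => z zs; apply: fg; right.
Qed.

Lemma tail_letters a : List.In a (behead (letters E)) -> ~~ is_start a.
Proof.
do 4!case=> [<-//|].
by elim: E => //= e E' IH [<-|].
Qed.

Lemma tail_states p : List.In p (drop 2 (states r)) -> ~~ is_root p.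
Proof.
do 12!case=> [<-//|].
by case/In_cat; rewrite /vecs; elim: (pairs r) => //= ij s IH [<-|].
Qed.

Definition zeros (n : nat) : seq rat := nseq n 0%R.

Definition starts (x : nat) : seq rat :=
  [:: start_weight x 0; start_weight x 1; start_weight x 2].

(** The numbers [2] and [5] are the positions of [Ini false 0] and [Ini true 0] among the 14 states
    before the [Vec] states; [9] and [6] count those left after the three [Ini] states. *)
Lemma root_row x b : [seq wt E fin r x Lstart (Root b) q | q <- states r] =
  zeros (if b then 5 else 2) ++ starts x ++
  zeros ((if b then 6 else 9) + (size (pairs r) + size (pairs r))).
Proof.
have zerosE c : [seq wt E fin r x Lstart (Root b) (Vec c ij.1 ij.2) | ij <- pairs r] =
    zeros (size (pairs r)).
  by rewrite /zeros; elim: (pairs r) => //= ij s ->.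
rewrite map_states !zerosE /zeros -nseqD.
by case: b {zerosE}.
Qed.

Lemma wa_M_template : exists rows mats, forall x,
  wa_M (chain E fin r x) =
  [:: [:: [seq wt E fin r x Lstart (Root false) q | q <- states r],
          [seq wt E fin r x Lstart (Root true) q | q <- states r] & rows] & mats].
Proof.
pose row x a p := [seq wt E fin r x a p q | q <- states r].
exists [seq row 0 Lstart p | p <- drop 2 (states r)].
exists [seq [seq row 0 a p | p <- states r] | a <- behead (letters E)] => x.
have rowE a p : ~~ (is_start a && is_root p) -> row x a p = row 0 a p.
  by move=> ok; apply: eq_map => q; exact: wt_irrelevant.
transitivity ([seq row x Lstart p | p <- states r] ::
    [seq [seq row x a p | p <- states r] | a <- behead (letters E)]); first by [].
congr (_ :: _); last first.
  apply: eq_map_In => a /tail_letters na; apply: eq_map => p; apply: rowE.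
  by rewrite (negPf na).
transitivity [:: row x Lstart (Root false), row x Lstart (Root true) &
    [seq row x Lstart p | p <- drop 2 (states r)]]; first by [].
by congr [:: _, _ & _]; apply: eq_map_In => p /tail_states np; exact: rowE.
Qed.

(* The numbers [n], ..., [F] are the parts of the encoding that do not depend
   on the input of the simulated machine. *)
Definition fill (n k t0 t1 rows mats F x : nat) : nat :=
  let z := enc_rat 0 in
  let s0 := enc_rat (start_weight x 0) in
  let s1 := enc_rat (start_weight x 1) in
  let s2 := enc_rat (start_weight x 2) in
  let cons a b := (cpair a b).+1 in
  cpair n (cpair k (cpair
    (cons (cons (cons z (cons z (cons s0 (cons s1 (cons s2 t0)))))
            (cons (cons z (cons z (cons z (cons z (cons z
                     (cons s0 (cons s1 (cons s2 t1))))))))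
              rows))
       mats) F)).

(** The parts are chosen before [x], so that they can be made the input [x] itself. *)
Lemma chain_template : exists n k t0 t1 rows mats F, forall x,
  enc_WA (chain E fin r x) = fill n k t0 t1 rows mats F x.
Proof.
have [rows [mats ME]] := wa_M_template.
pose tail n := enc_list enc_rat (zeros (n + (size (pairs r) + size (pairs r)))).
exists (size (states r)), (size (letters E)), (tail 9), (tail 6).
exists (enc_list (enc_list enc_rat) rows).
exists (enc_list (enc_list (enc_list enc_rat)) mats).
exists (enc_list nat_of_bool (map is_fin (states r))) => x.
by rewrite /enc_WA ME !root_row.
Qed.

End Template.

(** The argument serves twice: as the tuple of template parts, read by [arg], and as the number [x]
    in the start weights. *)
Definition cFill : code :=
  let z := cPair cZero (cConst 2) in
  let dbl f := cAdd f f in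
  let sq := cMul cId cId in
  let d := dbl (cAdd (cAdd sq cId) (cConst 1)) in
  let s0 := cPair (dbl sq) d in
  let s1 := cPair (dbl cId) d in
  let s2 := cPair (cConst 2) d in
  let arg i := cComp cFst (iter i (fun f => cComp f cSnd) cId) in
  cPair (arg 0) (cPair (arg 1) (cPair
    (cCons (cCons (cCons z (cCons z (cCons s0 (cCons s1 (cCons s2 (arg 2))))))
             (cCons (cCons z (cCons z (cCons z (cCons z (cCons z
                       (cCons s0 (cCons s1 (cCons s2 (arg 3)))))))))
               (arg 4)))
       (arg 5)) (iter 6 (fun f => cComp f cSnd) cId))).

Lemma ev_fill n k t0 t1 rows mats F :
  let x := cpair n (cpair k (cpair t0 (cpair t1 (cpair rows (cpair mats F))))) in
  eval cFill x (fill n k t0 t1 rows mats F x).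
Proof.
move=> x; have evx := ev_id x; have sq := ev_mul evx evx.
set d := cAdd (cAdd (cMul cId cId) cId) (cConst 1).
have evd : eval d x (denom x).
  by apply: ev_add (ev_const _ _); exact: ev_add.
have dbl f a : eval f x a -> eval (cAdd f f) x a.*2.
  by move=> fa; rewrite -addnn; exact: ev_add.
(* [denom x] is one modulo [x]. *)
have cop : coprime x (denom x).
  have -> : denom x = x.+1 * x + 1 by rewrite /denom mulSn addnAC [x + _]addnC; lia.
  by rewrite /coprime gcdnMDl gcdn1.
have d_gt0 : 0 < denom x by rewrite /denom addn1.
have ev0 : eval (cPair cZero (cConst 2)) x (enc_rat 0).
  have -> : enc_rat 0 = cpair 0 2 by [].
  exact: evPair (evZero _) (ev_const _ _).
have ev_s0 : eval (cPair (cAdd (cMul cId cId) (cMul cId cId)) (cAdd d d)) x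
    (enc_rat (start_weight x 0)).
  rewrite enc_rat_coprime ?coprimeMl ?cop //.
  by apply: evPair; [exact: dbl sq | exact: dbl evd].
have ev_s1 : eval (cPair (cAdd cId cId) (cAdd d d)) x (enc_rat (start_weight x 1)).
  rewrite enc_rat_coprime //.
  by apply: evPair; [exact: dbl evx | exact: dbl evd].
have ev_s2 : eval (cPair (cConst 2) (cAdd d d)) x (enc_rat (start_weight x 2)).
  rewrite -[start_weight x 2]/(1%:R / (denom x)%:R)%R enc_rat_coprime ?coprime1n //.
  by apply: evPair; [exact: ev_const | exact: dbl evd].
rewrite /cFill /fill; repeat first [exact: ev0 | exact: ev_s0 | exact: ev_s1
  | exact: ev_s2 | apply: ev_cons | apply: evPair].
all: rewrite /= /x; try (eapply evComp; [|apply evFst]).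
all: by repeat apply: ev_comp_snd; exact: ev_id.
Qed.

(** * Self-application, and reductions from deciders and approximations *)

Section Diagonal.
Variables (T : Type) (enc : T -> nat) (m : nat) (inst : WA -> T).
Hypothesis enc_inst : forall A, enc (inst A) = cpair (enc_WA A) m.

Definition halts_on (E : seq edge) (fin x : nat) : Prop :=
  exists t, epath (fun e => List.In e E) 0 (input_store x) fin t.

(* [cMu cFst] halts exactly on [0].  Given its own template as input, the
   program [d] below computes the chain that simulates this very run of [d],
   submits it to [e], and does the opposite of what [e] predicts. *)
Lemma no_halting_test (e : code) :
  ~ (forall E fin r x, 2 < r -> (forall f, List.In f E -> edge_ok r f) ->
       (halts_on E fin x -> exists v, eval e (enc (inst (chain E fin r x))) v.+1) /\
       (~ halts_on E fin x -> eval e (enc (inst (chain E fin r x))) 0)).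
Proof.
move=> test; pose d := cComp (cMu cFst) (cComp e (cPair cFill (cConst m))).
pose P := halting_prog d; have [r r2 okE] := edges_ok_bound (flow P 0).
have [n [k [t0 [t1 [rows [mats [F fillE]]]]]]] := chain_template (flow P 0) (plen P) r.
pose x := cpair n (cpair k (cpair t0 (cpair t1 (cpair rows (cpair mats F))))).
have [yes no] := test _ (plen P) _ x r2 okE.
have haltE : (exists y, eval d x y) <-> halts_on (flow P 0) (plen P) x.
  exact: halting_progP.
have evA : eval (cPair cFill (cConst m)) x (enc (inst (chain (flow P 0) (plen P) r x))).
  by rewrite enc_inst fillE; apply: evPair (ev_const _ _); exact: ev_fill.
have [h|nh] := pselect (halts_on (flow P 0) (plen P) x).
  have [v ev] := yes h; case/haltE: h => y /eval_CompI[z /eval_CompI[c ec ez]].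
  move=> /eval_MuI[/eval_FstI[u /cpair_inj[z0 _]] _].
  rewrite (eval_fun ec evA) in ez.
  by have := eval_fun ev ez; rewrite z0.
apply: (nh); apply/haltE; exists 0; apply: evComp (evComp evA (no nh)) _.
by apply: evMu => //; exact: (evFst 0 0).
Qed.

Definition cNot : code := cComp (cRec (cConst 1) cZero) (cPair cZero cId).

Lemma ev_not0 : eval cNot 0 1.
Proof.
apply: evComp; first by apply: evPair (evZero _) (ev_id _).
exact/evRec0/ev_const.
Qed.

Lemma ev_not1 : eval cNot 1 0.
Proof.
apply: evComp; first by apply: evPair (evZero _) (ev_id _).
by apply: evRecS (evZero _); exact/evRec0/ev_const.
Qed.

Lemma undecidable_chain (Pr P : T -> Prop) :
  (forall E fin r x, 2 < r -> (forall f, List.In f E -> edge_ok r f) ->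
     [/\ Pr (inst (chain E fin r x)),
         halts_on E fin x -> ~ P (inst (chain E fin r x)) &
         ~ halts_on E fin x -> P (inst (chain E fin r x))]) ->
  undecidable enc Pr P.
Proof.
move=> sep [c dec]; apply: (@no_halting_test (cComp cNot c)) => E fin r x r2 okE.
have [/dec[yes no] hP nhP] := sep E fin r x r2 okE; split.
  by move=> /hP /no ev; exists 0; apply: evComp ev ev_not0.
by move=> /nhP /yes ev; apply: evComp ev ev_not1.
Qed.

(** A nonnegative [n/d] in lowest terms is encoded by [2n] and [2d], so the truncated difference is
    positive iff the rational exceeds [4]. *)
Definition cGap : code := cSub cFst (cMul (cConst 4) cSnd).

Lemma ev_gap a b : eval cGap (cpair a b) (a - 4 * b).
Proof.
by apply: ev_sub; [constructor | apply: ev_mul; [exact: ev_const | constructor]].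
Qed.

Lemma ev_gap_large (q : rat) : (6 <= q)%R -> exists v, eval cGap (enc_rat q) v.+1.
Proof.
move=> q6; suff lt : (4 * enc_int (denq q) < enc_int (numq q))%N.
  exists (enc_int (numq q) - 4 * enc_int (denq q)).-1.
  by rewrite prednK ?subn_gt0 //; exact: ev_gap.
have d0 := denq_gt0 q; move: q6; rewrite -{1}(divq_num_den q).
rewrite ler_pdivlMr ?ltr0z // -[6%R]/(6%:~R)%R -intrM ler_int.
by move: d0; case: (denq q) => // d; case: (numq q) => n /=; lia.
Qed.

(** [enc_int] interleaves the signs, so a very negative rational would look large; the bound [-1]
    excludes this. *)
Lemma ev_gap_small (q : rat) : (-1 <= q <= 3)%R -> eval cGap (enc_rat q) 0.
Proof.
move=> /andP[ge le]; suff /eqP <- : (enc_int (numq q) - 4 * enc_int (denq q) == 0)%N.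
  exact: ev_gap.
have d0 := denq_gt0 q; move: ge le; rewrite -{1 2}(divq_num_den q).
rewrite ler_pdivlMr ?ltr0z // ler_pdivrMr ?ltr0z //.
rewrite -[3%R]/(3%:~R)%R -[(-1)%R]/((-1)%:~R)%R -!intrM !ler_int.
by move: d0; case: (denq q) => // d; case: (numq q) => n /=; lia.
Qed.

Lemma unsolvable_chain (Pr : T -> Prop) (Good : T -> rat -> Prop) :
  (forall E fin r x, 2 < r -> (forall f, List.In f E -> edge_ok r f) ->
     Pr (inst (chain E fin r x)) /\ forall q, Good (inst (chain E fin r x)) q ->
       (halts_on E fin x -> (6 <= q)%R) /\ (~ halts_on E fin x -> (-1 <= q <= 3)%R)) ->
  unsolvable enc Pr Good.
Proof.
move=> sep [c sol]; apply: (@no_halting_test (cComp cGap c)) => E fin r x r2 okE.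
have [/sol[q [ev good]] gap] := sep E fin r x r2 okE.
have [large small] := gap _ good; split=> [/large|/small].
  by move=> /ev_gap_large[v ev']; exists v; exact: evComp ev ev'.
by move=> /ev_gap_small ev'; exact: evComp ev ev'.
Qed.

End Diagonal.

(** * The individual problems *)

Section Problems.
Variable R : realType.
Local Open Scope ring_scope.

Lemma bigO_undecidable (Pr : WA * nat * nat -> Prop) :
  (forall E fin r x, Pr (chain E fin r x, root0, root1)) ->
  undecidable enc3 Pr (fun x => big_O R x.1.1 x.1.2 x.2).
Proof.
move=> PrP; pose inst A : WA * nat * nat := (A, root0, root1).
apply: (@undecidable_chain _ enc3 (cpair root0 root1) inst) => //.
move=> E fin r x r2 okE; split; first exact: PrP.
  exact: halting_not_bigO.
exact: diverging_bigO.
Qed.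

Lemma bigO_WA : bigO_problem_WA R.
Proof.
apply: bigO_undecidable => E fin r x; split; first exact: chain_wf.
exact: chain_states_ok.
Qed.

Lemma bigO_LMC : bigO_problem_LMC R.
Proof.
apply: bigO_undecidable => E fin r x; split; first exact: chain_LMC.
exact: chain_states_ok.
Qed.

Section Distance.
Variable d : WA -> nat -> nat -> \bar R.
Hypothesis dE : d = @tvx R \/ d = @tvx_sym R.

Let inst (t : rat) A : WA * nat * nat * rat := (A, mix0, mix1, t).

Lemma enc_inst t A : enc4 (inst t A) =
  cpair (enc_WA A) (cpair mix0 (cpair mix1 (enc_rat t))).
Proof. by []. Qed.

Lemma inst_promise t E fin r x : bounded_promise d (inst t (chain E fin r x)).
Proof.
split; first exact: chain_LMC.
split; first exact: chain_states_ok.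
by apply: le_lt_trans (dist_finite E fin r x dE) _; rewrite ltry.
Qed.

Lemma threshold_undecidable : threshold_problem d.
Proof.
(* Any threshold strictly between [2] and [8] separates the two cases. *)
apply: (undecidable_chain (enc_inst 4)) => E fin r x r2 okE.
split; first exact: inst_promise.
  move=> /(dist_halting (R := R) r2 okE dE) ge8 /= le4.
  by have := le_trans ge8 le4; rewrite ratr_nat lee_fin ler_nat.
move=> /(dist_diverging (R := R) r2 okE dE) le2 /=.
by apply: le_trans le2 _; rewrite ratr_nat lee_fin ler_nat.
Qed.

Lemma strict_threshold_undecidable : strict_threshold_problem d.
Proof.
apply: (undecidable_chain (enc_inst 4)) => E fin r x r2 okE.
split; first exact: inst_promise.
  move=> /(dist_halting (R := R) r2 okE dE) ge8 /= lt4.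
  by have := le_lt_trans ge8 lt4; rewrite ratr_nat lte_fin ltr_nat.
move=> /(dist_diverging (R := R) r2 okE dE) le2 /=.
by apply: le_lt_trans le2 _; rewrite ratr_nat lte_fin ltr_nat.
Qed.

Lemma fine_dist E fin r x : (2 < r)%N -> (forall f, List.In f E -> edge_ok r f) ->
  let t := fine (d (chain E fin r x) mix0 mix1) in
  [/\ 0 <= t, halts_on E fin x -> 8 <= t & ~ halts_on E fin x -> t <= 2].
Proof.
move=> r2 okE; have := dist_ge0 E fin r x dE.
have := dist_finite E fin r x dE.
have := dist_halting (R := R) r2 okE dE (fin := fin) (x := x).
have := dist_diverging (R := R) r2 okE dE (fin := fin) (x := x).
by case: (d _ _ _).
Qed.

Lemma additive_unsolvable : additive_approx_task d.
Proof.
(* With precision one, answers are at least [7] when the run halts, and between [-1] and [3]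
   otherwise. *)
apply: (unsolvable_chain (enc_inst 1)) => E fin r x r2 okE.
split=> [|q /=]; first by split; [exact: inst_promise | exact: ltr01].
have [] := fine_dist fin x r2 okE; set t := fine _ => t0 ge8 le2.
rewrite rmorph1 ler_norml => /andP[ge le]; split=> [/ge8 t8|/le2 t2].
  by rewrite -(ler_rat R) ratr_nat; lra.
by rewrite -!(ler_rat R) rmorphN rmorph1 ratr_nat; apply/andP; split; lra.
Qed.

Lemma multiplicative_unsolvable : multiplicative_approx_task d.
Proof.
(* With precision [1/4], answers are at least [(3/4) 8 = 6] when the run halts, and between [0] and
   [(5/4) 2 < 3] otherwise. *)
apply: (unsolvable_chain (enc_inst (1 / 4))) => E fin r x r2 okE.
split=> [|q /=]; first by split; [exact: inst_promise | exact: divr_gt0].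
have [] := fine_dist fin x r2 okE; set t := fine _ => t0 ge8 le2.
rewrite fmorph_div rmorph1 rmorph_nat => -[ge le]; split=> [/ge8 t8|/le2 t2].
  by rewrite -(ler_rat R) ratr_nat; lra.
by rewrite -!(ler_rat R) rmorphN rmorph1 ratr_nat; apply/andP; split; lra.
Qed.

End Distance.
End Problems.

Theorem theorem4p2 (R : realType) :
  (* (1) big-O problem: undecidable, even for labelled Markov chains *)
  (bigO_problem_WA R /\ bigO_problem_LMC R) /\
  (* (2) the four threshold problems, under the promise of boundedness *)
  (threshold_problem (@tvx R) /\ strict_threshold_problem (@tvx R) /\
   threshold_problem (@tvx_sym R) /\ strict_threshold_problem (@tvx_sym R)) /\
  (* (3) the four approximation tasks, under the promise of boundedness *)
  (additive_approx_task (@tvx R) /\ multiplicative_approx_task (@tvx R) /\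
   additive_approx_task (@tvx_sym R) /\ multiplicative_approx_task (@tvx_sym R)).
Proof.
have tl : @tvx R = @tvx R \/ @tvx R = @tvx_sym R by left.
have tr : @tvx_sym R = @tvx R \/ @tvx_sym R = @tvx_sym R by right.
split; first by split; [exact: bigO_WA | exact: bigO_LMC].
split.
  split; first exact: threshold_undecidable.
  split; first exact: strict_threshold_undecidable.
  by split; [exact: threshold_undecidable | exact: strict_threshold_undecidable].
split; first exact: additive_unsolvable.
split; first exact: multiplicative_unsolvable.
by split; [exact: additive_unsolvable | exact: multiplicative_unsolvable].
Qed.
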